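(* Let $p_1\equiv p_2\equiv1\pmod4$ be primes, $k=\mathbb{Q}(\sqrt{2p_1p_2},i)$, $\mathbb{K}_1=k(\sqrt{p_1})$. Let $\varepsilon_2$ be the fundamental unit of $\mathbb{Q}(\sqrt{2p_2})$ and $\varepsilon_3=x+y\sqrt{2p_1p_2}$ that of $\mathbb{Q}(\sqrt{2p_1p_2})$. Assume $N(\varepsilon_2)=N(\varepsilon_3)=1$. If $x+1$ or $x-1$ is a perfect square in $\mathbb{N}$, then $|\ker J_{\mathbb{K}_1}|=4$; otherwise $|\ker J_{\mathbb{K}_1}|=2$.
   Context: $i=\sqrt{-1}$; $x,y\in\mathbb{Z}$; $N$ is the norm to $\mathbb{Q}$. $J_{\mathbb{K}_1}:\mathbf{C}_k\to\mathbf{C}_{\mathbb{K}_1}$ is the homomorphism of ideal class groups induced by extension of ideals, and $\ker J_{\mathbb{K}_1}$ is the group of classes of $k$ capitulating in $\mathbb{K}_1$. *)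

(* Defs.v *)
From HB Require Import structures.
From mathcomp Require Import all_boot all_order all_algebra all_field.
Set Implicit Arguments. Unset Strict Implicit. Unset Printing Implicit Defensive.
Import Order.TTheory GRing.Theory Num.Theory.
Local Open Scope ring_scope.

Definition fld := algC -> Prop.

Definition Qf : fld := fun z => exists q : rat, z = ratr q.

(* F(a) for a with a^2 in F: { u + v a | u, v in F }. *)
Definition adj (F : fld) (a : algC) : fld :=
  fun z => exists u v, F u /\ F v /\ z = u + v * a.

Definition Qsqrt (m : nat) : fld := adj Qf (sqrtC m%:R).

Definition OK (F : fld) : algC -> Prop := fun z => F z /\ z \in Aint.

Definition ideal (F : fld) (I : algC -> Prop) : Prop :=
  [/\ exists z, I z /\ z != 0,
      forall z, I z -> OK F z,
      I 0,
      forall x y, I x -> I y -> I (x + y)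
    & forall r x, OK F r -> I x -> I (r * x)].

Definition ideal_equiv (F : fld) (I J : algC -> Prop) : Prop :=
  exists a b, [/\ OK F a, OK F b, a != 0, b != 0 &
    forall z, (exists w, I w /\ z = a * w) <-> (exists w, J w /\ z = b * w)].

Definition ext_ideal (K : fld) (I : algC -> Prop) : algC -> Prop :=
  fun z => exists s : seq (algC * algC),
    (forall p, p \in s -> I p.1 /\ OK K p.2) /\ z = \sum_(p <- s) p.1 * p.2.

Definition principal (K : fld) (I : algC -> Prop) : Prop :=
  exists g, OK K g /\ forall z, I z <-> exists y, OK K y /\ z = g * y.

(* I (ideal of O_k) capitulates in K: its class lies in ker J_K. *)
Definition capitulates (k K : fld) (I : algC -> Prop) : Prop :=
  ideal k I /\ principal K (ext_ideal K I).

Definition capitulation_card (k K : fld) (n : nat) : Prop :=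
  exists s : seq (algC -> Prop),
    [/\ size s = n,
        forall i, (i < n)%N -> capitulates k K (nth (fun _ => False) s i),
        forall i j, (i < n)%N -> (j < n)%N -> i <> j ->
          ~ ideal_equiv k (nth (fun _ => False) s i) (nth (fun _ => False) s j)
      & forall I, capitulates k K I ->
          exists2 i, (i < n)%N & ideal_equiv k I (nth (fun _ => False) s i)].

Definition unitO (F : fld) (u : algC) : Prop := OK F u /\ u != 0 /\ OK F u^-1.

Definition fund_unit (m : nat) (e : algC) : Prop :=
  [/\ unitO (Qsqrt m) e, 1 < e &
      forall u, unitO (Qsqrt m) u -> 1 < u -> e <= u].

Definition quad_norm (m : nat) (e : algC) (N : rat) : Prop :=
  exists a b : rat, e = ratr a + ratr b * sqrtC m%:R /\ N = a ^+ 2 - m%:R * b ^+ 2.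

(* Main.v *)
(* Let A = sqrt p1, B = sqrt (2 p2), D = AB, and let sg generate Gal(K1/k), so
   that sg A = - A, sg B = - B.  If an ideal I of k capitulates in K1 with
   generator g, then g / sg g is a unit of relative norm 1; as K1/k is
   unramified this identifies ker J with H^1(Gal(K1/k), E), that is, the units e
   of K1 with e sg(e) = 1 modulo the u / sg(u), u a unit.
   Such an e is real or purely imaginary, because e / conj(e) has trivial
   relative norms.  With eps1 a unit of norm -1 of Q(A), the product g = i eps1
   has relative norm 1, and multiplication by g exchanges the two cases.  A real
   e satisfies e^2 = eta theta with eta in Q(A) and theta in Q(B) of norm 1;
   there eta is a square, and theta is a square because sqrt 2 is not in K1, and
   one finds e = +- u / sg(u).  Hence H^1 is generated by -1 and g, and +-g is
   never trivial since g is imaginary.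
   Finally (x - 1)(x + 1) = 2 p1 p2 y^2 shows that 2, p1 or p2 times eps3 is a
   square in Q(D).  If p1 or p2, a square root of eps3, or of eps3 up to i, lies
   in K1 and is negated by sg, so that -1 is trivial.  The case of 2 occurs
   exactly when x + 1 or x - 1 is a square, and then -1 is not trivial. *)

Require Import Defs.
From HB Require Import structures.
From mathcomp Require Import all_boot all_order all_algebra all_field.
From mathcomp Require Import zify ring.
Set Implicit Arguments. Unset Strict Implicit. Unset Printing Implicit Defensive.
Import Order.TTheory GRing.Theory Num.Theory.

(** * Squares and Pell equations *)

(** The identification with H^1 is made by explicit generators, without factoring ideals. A
    capitulating ideal is recovered as the contraction of its extension; conversely any integer [a]
    of K1 for which [a / sg a] is a unit contracts to an ideal of k that extends to the one
    generated by [a]. The representatives of the classes are [1], [1 + g], [A] and [A (1 + g)], with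
    quotients 1, g, -1 and -g. The unit group of K1 is never determined. Only squares of units are
    computed, as products of units of quadratic subfields, which leaves a root of unity or a square
    class in doubt. The doubt is removed by the absence of sqrt 2, hence of primitive eighth roots
    of unity, from K1. In the quadratic subfields, square classes of units of norm 1 are read off
    from factorizations of Pell equations. Automorphisms are taken on all of [algC], so that they
    preserve integrality at once. *)

Lemma coprime_mul_sqr (m n c : nat) :
  coprime m n -> (m * n = c ^ 2)%N -> exists a, m = (a ^ 2)%N.
Proof.
move=> co_mn mnc; have [->|m_gt0] := posnP m; first by exists 0%N.
(* With m = m' g and c = c' g one has m' n = g c'^2. Then m' divides g, being coprime to c', and g
   divides m', being coprime to n; so m = g^2. *)
set g := gcdn m c; have g_gt0 : (0 < g)%N by rewrite gcdn_gt0 m_gt0.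
have [m' Dm] := dvdnP (dvdn_gcdl m c); have [c' Dc] := dvdnP (dvdn_gcdr m c).
rewrite -/g in Dm Dc.
have co' : coprime m' c'.
  have := erefl g; rewrite {1}/g {1}Dm {1}Dc -muln_gcdl.
  by move/eqP; rewrite -{2}(mul1n g) eqn_pmul2r.
have E : (m' * n = g * c' ^ 2)%N.
  by apply/eqP; rewrite -(eqn_pmul2r g_gt0) mulnAC -Dm mnc {1}Dc; apply/eqP; lia.
have d1 : (m' %| g)%N.
  by rewrite -(Gauss_dvdl _ (coprimeXr 2 co')) -E dvdn_mulr.
have d2 : (g %| m')%N.
  rewrite -(@Gauss_dvdl _ _ n) ?E ?dvdn_mulr //.
  by apply: coprime_dvdl co_mn; rewrite Dm dvdn_mull.
have e : m' = g by apply/eqP; rewrite eqn_dvd d1 d2.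
by exists g; rewrite Dm e.
Qed.

(** The factor [d1] is gcd(m, D). Once it is divided out, the rest of D is coprime to the rest of m,
    hence divides n, and the two cofactors are coprime with product c^2. *)
Lemma coprime_mul_sqr_fact (m n D c : nat) :
  (0 < D)%N -> coprime m n -> (m * n = D * c ^ 2)%N ->
  exists d1 d2 a b, [/\ (d1 * d2 = D)%N, m = (d1 * a ^ 2)%N & n = (d2 * b ^ 2)%N].
Proof.
move=> D_gt0 co_mn E; set g := gcdn m D.
have g_gt0 : (0 < g)%N by rewrite gcdn_gt0 D_gt0 orbT.
have [m' Dm] := dvdnP (dvdn_gcdl m D); have [D' DD] := dvdnP (dvdn_gcdr m D).
rewrite -/g in Dm DD.
have co' : coprime m' D'.
  have := erefl g; rewrite {1}/g {1}Dm {1}DD -muln_gcdl.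
  by move/eqP; rewrite -{2}(mul1n g) eqn_pmul2r.
have E1 : (m' * n = D' * c ^ 2)%N.
  by apply/eqP; rewrite -(eqn_pmul2r g_gt0) mulnAC -Dm E {1}DD; apply/eqP; lia.
have dn : (D' %| n)%N by rewrite -(@Gauss_dvdr _ m') ?E1 ?dvdn_mulr // coprime_sym.
have [n' Dn] := dvdnP dn.
have D'_gt0 : (0 < D')%N by move: D_gt0; rewrite DD; lia.
have E2 : (m' * n' = c ^ 2)%N.
  by apply/eqP; rewrite -(eqn_pmul2l D'_gt0) -E1 Dn; apply/eqP; lia.
have co2 : coprime m' n'.
  apply: (@coprime_dvdl _ m); first by rewrite Dm dvdn_mulr.
  by apply: (@coprime_dvdr _ n) => //; rewrite Dn dvdn_mulr.
have [a Da] := coprime_mul_sqr co2 E2.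
have [b Db] : exists b, n' = (b ^ 2)%N.
  by apply: (@coprime_mul_sqr n' m' c); rewrite 1?coprime_sym // mulnC.
by exists g, D', a, b; rewrite -Da -Db DD Dm Dn; split; lia.
Qed.

Definition squarefree (m : nat) := forall r, prime r -> ~~ (r ^ 2 %| m)%N.

Lemma squarefree_prime_mul p m :
  prime p -> ~~ (p %| m)%N -> squarefree m -> squarefree (p * m).
Proof.
move=> pp pm sm r rp; apply/negP; have [->|rNp] := eqVneq r p.
  by rewrite -mulnn dvdn_pmul2l ?prime_gt0 // (negPf pm).
rewrite Gauss_dvdr; first by apply/negP; apply: sm.
by rewrite coprimeXl // prime_coprime // dvdn_prime2.
Qed.

Lemma squarefree1 : squarefree 1.
Proof.
move=> r rp; rewrite dvdn1 -(exp1n 2) eqn_exp2r //.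
by have := prime_gt1 rp; lia.
Qed.

Lemma squarefree_prime p : prime p -> squarefree p.
Proof.
move=> pp; rewrite -(muln1 p); apply: squarefree_prime_mul squarefree1 => //.
by rewrite dvdn1; have := prime_gt1 pp; lia.
Qed.

(** The halves of m + 1 and m - 1 are consecutive integers, hence coprime, and their product is D
    (n/2)^2. *)
Lemma pell_even_split (m n D : nat) :
  (0 < D)%N -> (m ^ 2 = D * n ^ 2 + 1)%N -> odd m -> ~~ odd n ->
  exists d1 d2 a b, [/\ (d1 * d2 = D)%N, (m + 1 = 2 * d1 * a ^ 2)%N,
    (m - 1 = 2 * d2 * b ^ 2)%N & (n = 2 * (a * b))%N].
Proof.
move=> D_gt0 E om en.
have [k Dk] : exists k, m = (2 * k + 1)%N by exists (m./2); lia.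
have [l Dl] : exists l, n = (2 * l)%N by exists (n./2); lia.
have E2 : (k.+1 * k = D * l ^ 2)%N.
  apply/eqP; rewrite -(eqn_pmul2l (isT : (0 < 4)%N)); apply/eqP.
  move: E; rewrite Dk Dl; nia.
have [d1 [d2 [a [b [DE Ha Hb]]]]] := coprime_mul_sqr_fact D_gt0 (coprimeSn k) E2.
exists d1, d2, a, b; split=> //; try lia.
rewrite Dl; congr (2 * _)%N; apply/eqP; rewrite -(eqn_exp2r _ _ (isT : (0 < 2)%N)).
rewrite -(eqn_pmul2l D_gt0) -E2 Ha Hb -DE; apply/eqP; lia.
Qed.

Lemma pell_even (m n D : nat) : ~~ odd D -> ~~ (4 %| D)%N ->
  (m ^ 2 = D * n ^ 2 + 1)%N -> odd m /\ ~~ odd n.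
Proof.
move=> eD D4 E.
have [d Dd] : exists d, D = (2 * (2 * d + 1))%N by exists (D./2./2); lia.
have om : odd m by have := congr1 odd E; rewrite oddX oddD oddM (negPf eD) /=.
split=> //; apply/negP => on.
have [k Dk] : exists k, m = (2 * k + 1)%N by exists (m./2); lia.
have [l Dl] : exists l, n = (2 * l + 1)%N by exists (n./2); lia.
move: E; rewrite Dk Dl Dd; nia.
Qed.

Lemma pell_1mod4 (m n p : nat) : (p %% 4 = 1)%N ->
  (m ^ 2 = p * n ^ 2 + 1)%N -> odd m /\ ~~ odd n.
Proof.
move=> p4 E.
have [q Dq] : exists q, p = (4 * q + 1)%N by exists (p %/ 4)%N; lia.
have [k Dk] : exists k, m = (2 * k + odd m)%N by exists (m./2); lia.
have [l Dl] : exists l, n = (2 * l + odd n)%N by exists (n./2); lia.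
move: E Dk Dl; rewrite Dq; case: (odd m); case: (odd n) => E Dk Dl; subst; split => //; nia.
Qed.

Local Open Scope ring_scope.

(** * Solvability of Pell's equation *)

Lemma seq_repeat (T : finType) (f : nat -> T) : exists i j, (i < j)%N /\ f i = f j.
Proof.
pose g (i : 'I_#|T|.+1) := f i.
have : ~~ injectiveb g.
  by apply/negP => /injectiveP /leq_card; rewrite card_ord ltnn.
move=> /injectivePn [i [j ij Dij]].
have : (i != j :> nat) by [].
rewrite neq_ltn => /orP[?|?]; first by exists i, j.
by exists j, i; split; last exact: esym.
Qed.

(* Conway's river: (a, h, c) is the form a X^2 + 2h XY - c Y^2; a step replaces one of the two
   basis vectors by their sum, keeping one value positive and one negative. *)
Definition river_step (s : int * int * int) : int * int * int :=
  let: (a, h, c) := s in let m := a + 2 * h - c in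
  if 0 < m then (m, h - c, c) else (a, a + h, - m).

(** The invariant h^2 + a c is a quarter of the discriminant; with both signs fixed it bounds a, h
    and c. *)
Definition river_state (p : int) (s : int * int * int) :=
  let: (a, h, c) := s in [/\ 0 < a, 0 < c & h ^+ 2 + a * c = p].

Section River.
Variable p : nat.
Hypothesis pNsqr : forall z : int, z ^+ 2 != p%:Z.

Lemma river_stepP s : river_state p s -> river_state p (river_step s).
Proof.
case: s => [[a h] c] [a_gt0 c_gt0 E] /=.
have Hn := pNsqr (h - c); have Hm : a + 2 * h - c != 0.
  (* If the new value a + 2 h - c vanished, then (h + a)^2 = h^2 + a c = p. *)
  by apply/negP => /eqP H0; move: (pNsqr (h + a)) => /eqP; apply; nia.
case: ifP => Hm0; split; rewrite //; try lia; nia.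
Qed.

(** The form at the difference of the two new basis vectors is positive if the first vector was
    replaced and negative if the second was, so the step can be undone. *)
Lemma river_step_inj s t :
  river_state p s -> river_state p t -> river_step s = river_step t -> s = t.
Proof.
case: s t => [[a h] c] [[a' h'] c'] [? ? E] [? ? E'] /=.
by do 2 case: ifP => ?; case=> *; do 2?congr pair; lia.
Qed.

Let st n := iter n river_step (1, 0, p%:Z).

Lemma p_gt0 : (0 < p)%N.
Proof. by have := pNsqr 0; rewrite lt0n expr0n eq_sym. Qed.

Lemma st_state n : river_state p (st n).
Proof.
elim: n => [|n IHn] /=; last exact: river_stepP.
by split=> //; rewrite ?ltz_nat ?p_gt0 // expr0n add0r mul1r.
Qed.

(** There are finitely many states, and injectivity of the step carries a repetition back to the
    initial form X^2 - p Y^2. *)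
Lemma river_return : exists2 n, (0 < n)%N & st n = st 0.
Proof.
(* As a, c and the absolute value of h are at most p, the shift of h by p makes all three codes
   naturals up to 2 p. *)
pose code (s : int * int * int) : 'I_(2 * p).+1 * 'I_(2 * p).+1 * 'I_(2 * p).+1 :=
  (inord `|s.1.1|%N, inord (absz (s.1.2 + p%:Z)%R), inord `|s.2|%N).
have code_inj s t : river_state p s -> river_state p t -> code s = code t -> s = t.
  case: s t => [[a h] c] [[a' h'] c'] [? ? E] [? ? E'] [].
  have ? : (a <= p%:Z) by nia. have ? : (c <= p%:Z) by nia.
  have ? : (a' <= p%:Z) by nia. have ? : (c' <= p%:Z) by nia.
  have ? : (-p%:Z <= h <= p%:Z) by nia.
  have ? : (-p%:Z <= h' <= p%:Z) by nia.
  move=> /(congr1 val) /= + /(congr1 val) /= + /(congr1 val) /=.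
  rewrite !inordK; try lia.
  by move=> *; do 2?congr pair; lia.
have [i [j [ij Dij]]] := seq_repeat (fun n => code (st n)).
have {}Dij := code_inj _ _ (st_state i) (st_state j) Dij.
exists (j - i)%N; first by rewrite subn_gt0.
elim: i j ij Dij => [|i IHi] j; first by rewrite subn0.
case: j => // j ij Dij; rewrite subSS; apply: IHi => //.
exact: river_step_inj (st_state i) (st_state j) Dij.
Qed.

(** State n is X^2 - p Y^2 written in the basis (u1, u2), (v1, v2). The coordinate sum grows at
    every step, so a return to the initial form happens in a different basis. *)
Lemma river_basis n : exists u1 u2 v1 v2 : int,
  [/\ st n = (u1 ^+ 2 - p%:Z * u2 ^+ 2, u1 * v1 - p%:Z * u2 * v2,
             p%:Z * v2 ^+ 2 - v1 ^+ 2),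
      [/\ 0 <= u1, 0 <= u2, 0 <= v1 & 0 <= v2],
      0 < u1 + u2, 0 < v1 + v2 & 2 + n%:Z <= u1 + u2 + v1 + v2].
Proof.
elim: n => [|n [u1 [u2 [v1 [v2 [E [? ? ? ?] ? ? ?]]]]]].
  by exists 1, 0, 0, 1; split=> //; congr (_, _, _); ring.
rewrite /st iterS -/(st n) E /=.
case: ifP => _; [exists (u1 + v1), (u2 + v2), v1, v2|exists u1, u2, (u1 + v1), (u2 + v2)];
  by split; [congr (_, _, _); ring | split; lia | lia | lia | lia].
Qed.

(** On return to the initial form the first basis vector has value 1. If u2 were 0 the basis would
    be the initial one, whose coordinate sum 2 is too small after n > 0 steps. *)
Lemma pell_exists : exists t u : nat, (0 < u)%N /\ (t ^ 2 = p * u ^ 2 + 1)%N.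
Proof.
have [n n_gt0 Dn] := river_return.
have [u1 [u2 [v1 [v2 [E [? ? ? ?] ? ? ?]]]]] := river_basis n.
move: E; rewrite Dn /= => -[Ea Eh Ec].
exists `|u1|%N, `|u2|%N; split; last by nia.
rewrite absz_gt0; apply/eqP => u20; subst u2.
have p0 := p_gt0.
have u11 : u1 = 1 by nia.
have v10 : v1 = 0 by nia.
have v21 : v2 = 1 by nia.
by lia.
Qed.

End River.

Lemma prime_Nsqr p : prime p -> forall z : int, z ^+ 2 != p%:Z.
Proof.
move=> pp z; apply/eqP => E.
have {}E : (`|z| ^ 2 = p)%N by lia.
have p1 := prime_gt1 pp; have H := squarefree_prime pp.
have z1 : (1 < `|z|)%N by case: (`|z|)%N E p1 => [|[|k]] <-.
by have := H _ (pdiv_prime z1); rewrite -E dvdn_exp2r // pdiv_dvd.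
Qed.

(* Descent: halving the unit t + u sqrt p in the exponent must stop, and it
   can only stop at a unit of norm -1. *)
Lemma negative_pell p : prime p -> (p %% 4 = 1)%N ->
  exists b a : nat, (b ^ 2 + 1 = p * a ^ 2)%N.
Proof.
move=> pp p4; have [t [u [u_gt0 E]]] := pell_exists (prime_Nsqr pp).
elim/ltn_ind: t u u_gt0 E => t IHt u u_gt0 E.
have [ot ou] := pell_1mod4 p4 E.
have [d1 [d2 [a [b [DE Ha Hb Hu]]]]] := pell_even_split (prime_gt0 pp) E ot ou.
have t_gt1 : (1 < t)%N by have := prime_gt0 pp; nia.
have : (d1 %| p)%N by rewrite -DE dvdn_mulr.
move/primeP: (pp) => [_ /[apply]] /orP[]/eqP D1; subst d1.
  have D2 : d2 = p by lia.
  subst d2; have Eb : (a ^ 2 = p * b ^ 2 + 1)%N by lia.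
  have b_gt0 : (0 < b)%N by case: b Hu {Hb Eb} => [|//]; lia.
  have a_gt0 : (0 < a)%N by move: Eb; rewrite lt0n; case: (a) => //; lia.
  have a_lt : (a < t)%N.
    have a_le : (a <= a ^ 2)%N by rewrite -mulnn leq_pmulr.
    by clear - Ha t_gt1 a_le; lia.
  exact: (IHt a a_lt b).
have D2 : d2 = 1%N by have p0 := prime_gt0 pp; move/eqP: DE; rewrite -{2}(muln1 p) eqn_pmul2l // => /eqP.
by subst d2; exists b, a; lia.
Qed.

(** * Automorphisms and integrality *)

Section QuadraticExtension.
Variables (F : fieldType) (L : fieldExtType F) (E : {subfield L}) (x : L).
Hypothesis Ex2 : x ^+ 2 \in E.

Let sqrPoly : 'X^2 - (x ^+ 2)%:P \is a polyOver E.
Proof. by rewrite rpredB ?rpredX ?polyOverX ?polyOverC. Qed.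

Let minPoly_sqr : minPoly E x %| 'X^2 - (x ^+ 2)%:P.
Proof. by apply: minPoly_dvdp => //; rewrite /root !hornerE subrr. Qed.

Lemma Fadjoin_sqrtP z :
  z \in <<E; x>>%VS -> exists u v, [/\ u \in E, v \in E & z = u + v * x].
Proof.
move=> Ez; set p := Fadjoin_poly E x z.
have Ep : p \is a polyOver E by apply: Fadjoin_polyOver.
have sp : (size p <= 2)%N.
  apply: leq_trans (size_Fadjoin_poly _ _ _) _.
  have := dvdp_leq _ minPoly_sqr; rewrite size_minPoly size_XnsubC //; apply.
  by rewrite -size_poly_gt0 size_XnsubC.
exists p`_0, p`_1; split; rewrite ?(polyOverP Ep) //.
rewrite -(Fadjoin_poly_eq Ez) -/p (horner_coef_wide _ sp).
by rewrite !big_ord_recr big_ord0 /= add0r expr0 mulr1 expr1.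
Qed.

Lemma minPoly_sqrt : x \notin E -> minPoly E x = 'X^2 - (x ^+ 2)%:P.
Proof.
move=> xE; apply/eqP; rewrite -eqp_monic ?monic_minPoly ?monicXnsubC //.
rewrite -dvdp_size_eqp // size_minPoly size_XnsubC // eqSS.
have := dvdp_leq _ minPoly_sqr; rewrite size_minPoly size_XnsubC // => /(_ _)/wrap[].
  by rewrite -size_poly_gt0 size_XnsubC.
rewrite ltnS leq_eqVlt => /orP[//|].
have := adjoin_deg_eq1 E x; rewrite (negPf xE).
rewrite /adjoin_degree; case: (_.-1) => [|k] //.
Qed.

End QuadraticExtension.

(** The last hypothesis says in coordinates that a lies outside Q(x, y). Its minimal polynomial
    there is X^2 - a^2, so a -> -a extends to the number field Q(x, y, a) and from there to
    [algC]. *)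
Lemma biquadratic_aut (x y a : algC) (qx qy qa : rat) :
  x ^+ 2 = ratr qx -> y ^+ 2 = ratr qy -> a ^+ 2 = ratr qa ->
  (forall u v w t : rat,
     a != ratr u + ratr v * x + (ratr w + ratr t * x) * y) ->
  exists nu : {rmorphism algC -> algC}, [/\ nu x = x, nu y = y & nu a = - a].
Proof.
move=> Hx Hy Ha aN.
have [Qs [QsC [s1 Ds1 genQs]]] := num_field_exists [:: x; y; a].
case: s1 Ds1 genQs => [|x1 [|y1 [|a1 [|? ?]]]] //= [Dx Dy Da] genQs.
have ratC q : QsC q%:A = ratr q by rewrite alg_num_field fmorph_rat.
have sqr1 (z : Qs) q : QsC z ^+ 2 = ratr q -> z ^+ 2 = q%:A.
  by move=> e; apply: (fmorph_inj QsC); rewrite ratC -e rmorphXn.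
pose E1 := <<1%AS; x1>>%AS; pose E := <<E1; y1>>%AS.
have x2E : x1 ^+ 2 \in 1%AS by rewrite (@sqr1 _ qx) ?Dx ?memvZ ?mem1v.
have y2E : y1 ^+ 2 \in E1 by rewrite (@sqr1 _ qy) ?Dy ?memvZ ?mem1v.
have a2E : a1 ^+ 2 \in E by rewrite (@sqr1 _ qa) ?Da ?memvZ ?mem1v.
have E1P z : z \in E1 -> exists u v : rat, QsC z = ratr u + ratr v * x.
  move=> /(Fadjoin_sqrtP x2E)[_ [_ [/vlineP[u ->] /vlineP[v ->] ->]]].
  by exists u, v; rewrite rmorphD rmorphM /= !ratC Dx.
have aE : a1 \notin E.
  apply/negP => /(Fadjoin_sqrtP y2E)[z [t [/E1P[u [v Dz]] /E1P[w [t' Dt]] Da1]]].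
  move/eqP: (aN u v w t'); apply.
  by rewrite -Da Da1 rmorphD rmorphM /= Dz Dt Dy.
pose phi := kHomExtend E \1 a1 (- a1).
have homE : kHom 1 E (\1%VF : 'End(Qs)) by rewrite kHom1.
have rootE : root (map_poly \1%VF (minPoly E a1)) (- a1).
  rewrite lfun1_poly minPoly_sqrt // /root.
  by rewrite !hornerE sqrrN subrr.
have fullE : (<<E; a1>> = fullv)%VS.
  by rewrite -genQs !adjoin_cons adjoin_nil subfield_closed.
have phim : monoid_morphism phi.
  apply/kHom_monoid_morphism; rewrite -fullE.
  exact: (kHomExtendP (sub1v _) homE rootE).
pose phimM := GRing.isMonoidMorphism.Build _ _ phi phim.
pose phiRM : {rmorphism _ -> _} := HB.pack (fun_of_lfun phi) phimM.
have [nu Dnu] := extend_algC_subfield_aut QsC phiRM.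
have phiE z : z \in E -> phi z = z by move=> Ez; rewrite /phi kHomExtend_id ?id_lfunE.
exists nu; split.
- by rewrite -Dx -Dnu /= phiE // subvP_adjoin // memv_adjoin.
- by rewrite -Dy -Dnu /= phiE // memv_adjoin.
by rewrite -Da -Dnu /= /phi (kHomExtend_val homE rootE) rmorphN.
Qed.

Lemma Aint_sqr (z : algC) : z ^+ 2 \in Aint -> z \in Aint.
Proof.
rewrite unfold_in => Zp; apply: (@root_monic_Aint (minCpoly (z ^+ 2) \Po 'X^2)).
- by rewrite /root horner_comp hornerXn -/(root _ _) root_minCpoly.
- rewrite monicE lead_coef_comp ?size_polyXn // lead_coefXn expr1n mulr1.
  exact: minCpoly_monic.
by rewrite polyOver_comp // rpredX // polyOverX.
Qed.

(** The square of the denominator of q is coprime to that of the numerator, hence divides m. *)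
Lemma squarefree_ratint (m : nat) (q : rat) :
  squarefree m -> m%:R * q ^+ 2 \in Num.int -> q \in Num.int.
Proof.
move=> sm /intrP[N E].
have Eint : m%:Z * numq q ^+ 2 = N * denq q ^+ 2.
  apply: (@intr_inj rat).
  rewrite [LHS]rmorphM [RHS]rmorphM [in LHS]rmorphXn [in RHS]rmorphXn /= numqE -E -pmulrn.
  by rewrite exprMn mulrA.
suff d1 : (`|denq q| = 1)%N.
  apply/intrP; exists (numq q); rewrite -{1}(divq_num_den q).
  have -> : denq q = 1 by have := denq_gt0 q; lia.
  by rewrite divr1.
apply/eqP; rewrite eqn_leq; apply/andP; split; last by have := denq_gt0 q; lia.
rewrite leqNgt; apply/negP => d1; set d := `|denq q|%N in d1.
have dm : (d ^ 2 %| m)%N.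
  rewrite -(@Gauss_dvdl _ m (`|numq q| ^ 2)); last first.
    by rewrite coprimeXl // coprimeXr // coprime_sym coprime_num_den.
  apply/dvdnP; exists `|N|%N; move/(congr1 absz): Eint.
  by rewrite [LHS]abszM [RHS]abszM !abszX.
have := sm _ (pdiv_prime d1); rewrite (dvdn_trans _ dm) //.
by rewrite dvdn_exp2r // pdiv_dvd.
Qed.

Lemma squarefree_Nsqr (m : nat) (q : rat) :
  squarefree m -> (1 < m)%N -> q ^+ 2 != m%:R.
Proof.
move=> sm m_gt1; apply/eqP => E.
have /intrP[z Dz] : q \in Num.int.
  have m0 : (m%:R : rat) != 0 by rewrite pnatr_eq0; lia.
  (* The integrality criterion applies to q / m because m (q / m)^2 = 1. *)
  have /intrP[z Dz] : q / m%:R \in Num.int.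
    apply: (squarefree_ratint sm); rewrite expr_div_n E.
    by have -> : m%:R * (m%:R / m%:R ^+ 2) = 1 :> rat by field.
  by rewrite -(divfK m0 q) Dz rpredM // ?rpred_int ?rpred_nat.
have {}E : (`|z| ^ 2 = m)%N.
  move: E; rewrite Dz -rmorphXn /= pmulrn => /eqP; rewrite eqr_int => /eqP; lia.
have z1 : (1 < `|z|)%N by case: (`|z|)%N E m_gt1 => [|[|k]] <-.
by have := sm _ (pdiv_prime z1); rewrite -E dvdn_exp2r // pdiv_dvd.
Qed.

(** * Subfields of algC, coordinates and units *)

Record subfield (F : fld) : Prop := Subfield {
  subfield_rat : forall q : rat, F (ratr q);
  subfieldD : forall x y, F x -> F y -> F (x + y);
  subfieldM : forall x y, F x -> F y -> F (x * y);
  subfieldV : forall x, F x -> F x^-1 }.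

Section SubfieldTheory.
Variable F : fld.
Hypothesis FF : subfield F.

Lemma subfield_nat n : F n%:R. Proof. by have := subfield_rat FF n%:R; rewrite ratr_nat. Qed.
Lemma subfield_int n : F n%:~R. Proof. by have := subfield_rat FF n%:~R; rewrite ratr_int. Qed.
Lemma subfield0 : F 0. Proof. exact: (subfield_nat 0). Qed.
Lemma subfield1 : F 1. Proof. exact: (subfield_nat 1). Qed.
Lemma subfieldN x : F x -> F (- x).
Proof. by move=> Fx; rewrite -mulN1r; apply: subfieldM => //; apply: (subfield_int (-1)). Qed.
Lemma subfieldB x y : F x -> F y -> F (x - y).
Proof. by move=> Fx Fy; apply: subfieldD => //; apply: subfieldN. Qed.
Lemma subfieldX x n : F x -> F (x ^+ n).
Proof.
move=> Fx; elim: n => [|n IHn]; first exact: subfield1.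
by rewrite exprS; apply: subfieldM.
Qed.

Lemma adj_sub a x : F x -> adj F a x.
Proof. by move=> Fx; exists x, 0; rewrite mul0r addr0; do 2?split=> //; apply: subfield0. Qed.

Lemma adj_gen a : adj F a a.
Proof. by exists 0, 1; rewrite mul1r add0r; do 2?split=> //; [apply: subfield0 | apply: subfield1]. Qed.

Lemma adj_subfield a : F (a ^+ 2) -> subfield (adj F a).
Proof.
move=> Fa2; split=> [q|x y|x y|x].
- by apply: adj_sub; apply: subfield_rat.
- move=> [u [v [Fu [Fv ->]]]] [u' [v' [Fu' [Fv' ->]]]].
  by exists (u + u'), (v + v'); rewrite mulrDl addrACA; do 2?split=> //; apply: subfieldD.
- move=> [u [v [Fu [Fv ->]]]] [u' [v' [Fu' [Fv' ->]]]].
  exists (u * u' + v * v' * a ^+ 2), (u * v' + v * u'); do 2?split; last by ring.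
    by apply: subfieldD => //; repeat apply: subfieldM => //.
  by apply: subfieldD => //; repeat apply: subfieldM => //.
move=> [u [v [Fu [Fv ->]]]].
(* Since [a] may already lie in F, the norm can vanish on a nonzero element; then u = v a, and the
   element lies in F. *)
have [n0|n0] := eqVneq (u ^+ 2 - v ^+ 2 * a ^+ 2) 0.
  apply: adj_sub; apply: subfieldV => //.
  have [v0|v0] := eqVneq v 0; first by rewrite v0 mul0r addr0.
  have : (u - v * a) * (u + v * a) = 0 by rewrite -n0; ring.
  move/eqP; rewrite mulf_eq0 => /orP[]; last by move/eqP ->; apply: subfield0.
  rewrite subr_eq0 => /eqP <-; exact: subfieldD.
have s0 : u + v * a != 0.
  apply: contraNneq n0 => e.
  by have -> : u ^+ 2 - v ^+ 2 * a ^+ 2 = (u - v * a) * (u + v * a) by [ring]; rewrite e mulr0.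
have Fn : F (u ^+ 2 - v ^+ 2 * a ^+ 2)^-1.
  by apply: subfieldV => //; apply: subfieldB; rewrite -?exprMn ?exprMn; repeat (apply: subfieldM => // || apply: subfieldX => //).
exists (u * (u ^+ 2 - v ^+ 2 * a ^+ 2)^-1), (- v * (u ^+ 2 - v ^+ 2 * a ^+ 2)^-1); do 2?split.
- by apply: subfieldM.
- by apply: subfieldM => //; apply: subfieldN.
apply: (mulfI s0); rewrite mulfV //.
have := mulfV n0; set ni := _^-1 => <-.
by ring.
Qed.
End SubfieldTheory.

Lemma Qf_subfield : subfield Qf.
Proof.
split=> [q|_ _ [q ->] [r ->]|_ _ [q ->] [r ->]|_ [q ->]]; first by exists q.
- by exists (q + r); rewrite rmorphD.
- by exists (q * r); rewrite rmorphM.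
by exists q^-1; rewrite fmorphV.
Qed.

Lemma Qsqrt_subfield m : subfield (Qsqrt m).
Proof.
apply: (adj_subfield Qf_subfield); rewrite sqrtCK.
exact: (subfield_nat Qf_subfield).
Qed.

(** The binary digits of an index, lowest first, tell whether z, x and y occur in the corresponding
    basis element. *)
Definition basis_sum (x y z : algC) (a : nat -> rat) : algC :=
  ratr (a 0%N) + ratr (a 1%N) * z + (ratr (a 2%N) + ratr (a 3%N) * z) * x
  + (ratr (a 4%N) + ratr (a 5%N) * z + (ratr (a 6%N) + ratr (a 7%N) * z) * x) * y.

Lemma aut_basis_sum (nu : {rmorphism algC -> algC}) x y z a :
  nu (basis_sum x y z a) = basis_sum (nu x) (nu y) (nu z) a.
Proof. by rewrite /basis_sum !(fmorph_rat, rmorphD, rmorphM). Qed.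

Lemma conj_basis_sum x y z a : (basis_sum x y z a)^* = basis_sum x^* y^* z^* a.
Proof. exact: (aut_basis_sum Num.conj). Qed.

Lemma conjCN (x : algC) : (- x)^* = - x^*.
Proof. exact: (rmorphN Num.conj). Qed.

Lemma ratr_mul_nat (q : rat) n : ratr (q * n%:R) = ratr q * n%:R :> algC.
Proof. by rewrite rmorphM /= ratr_nat. Qed.

Lemma aut_lin (nu : {rmorphism algC -> algC}) u v x : nu (u + v * x) = nu u + nu v * nu x.
Proof. by rewrite rmorphD rmorphM. Qed.

Lemma conjCM (x y : algC) : (x * y)^* = x^* * y^*.
Proof. exact: (rmorphM Num.conj). Qed.

Lemma conjC_lin (u v x : algC) : (u + v * x)^* = u^* + v^* * x^*.
Proof. exact: (aut_lin Num.conj). Qed.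

Lemma aut_monomial (nu : {rmorphism algC -> algC}) x y z a b c :
  nu (x ^+ a * y ^+ b * z ^+ c) = nu x ^+ a * nu y ^+ b * nu z ^+ c.
Proof. by rewrite !rmorphM !rmorphXn. Qed.

Lemma conjC_monomial (x y z : algC) a b c :
  (x ^+ a * y ^+ b * z ^+ c)^* = x^* ^+ a * y^* ^+ b * z^* ^+ c.
Proof. exact: (aut_monomial Num.conj). Qed.

(** An element fixed by a group of four automorphisms is the mean of its images, in which the
    unwanted coordinates cancel. Linear independence of the basis is thereby avoided. *)
Lemma average4 (w w1 w2 w3 v : algC) :
  w1 = w -> w2 = w -> w3 = w -> w + w1 + w2 + w3 = 4 * v -> w = v.
Proof.
move=> -> -> -> E; apply: (mulfI (_ : (4 : algC) != 0)); first by rewrite pnatr_eq0.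
by rewrite -E; ring.
Qed.

Lemma sqrt_real (n : nat) : sqrtC (n%:R : algC) \is Num.real.
Proof. by rewrite ger0_real // sqrtC_ge0 ler0n. Qed.

Lemma conj_sqrt (n : nat) : Num.conj (sqrtC (n%:R : algC)) = sqrtC n%:R.
Proof. exact/CrealP/sqrt_real. Qed.

Lemma conj_i : Num.conj ('i : algC) = - 'i. Proof. exact: conjCi. Qed.

Lemma sqrtC_nat_eq0 n : (0 < n)%N -> sqrtC (n%:R : algC) != 0.
Proof. by move=> n_gt0; rewrite sqrtC_eq0 pnatr_eq0 -lt0n. Qed.

Lemma ratr_conj (q : rat) : Num.conj (ratr q : algC) = ratr q.
Proof. exact: fmorph_rat. Qed.

(** Adding the complex conjugate removes 'i. Squaring the rest makes 2 u w sqrt n rational, so u w =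
    0, and then m or m / n is a rational square. *)
Lemma sqrt_notin (m n : nat) : squarefree m -> (1 < m)%N ->
  squarefree n -> (1 < n)%N -> (forall q : rat, m%:R != n%:R * q ^+ 2) ->
  forall u v w t : rat, sqrtC (m%:R : algC) != ratr u + ratr v * 'i + (ratr w + ratr t * 'i) * sqrtC n%:R.
Proof.
move=> sm m1 sn n1 mn u v w t; apply/eqP => E.
have E1 : sqrtC (m%:R : algC) = ratr u + ratr w * sqrtC n%:R.
  have := congr1 (fun z => z + Num.conj z) E.
  rewrite !(fmorph_rat, rmorphD, rmorphM) /= !conj_sqrt conj_i => E'.
  have h2 : (2%:R : algC) != 0 by rewrite pnatr_eq0.
  apply: (mulfI h2); apply/eqP; rewrite -subr_eq0; move/eqP: E'; rewrite -subr_eq0.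
  by congr (_ == _); ring.
have n0 : sqrtC (n%:R : algC) != 0 by rewrite sqrtC_nat_eq0 // ltnW.
have E2 : ratr (m%:R - u ^+ 2 - w ^+ 2 * n%:R) = ratr (2 * u * w) * sqrtC n%:R :> algC.
  have : (sqrtC (m%:R : algC)) ^+ 2 = (ratr u + ratr w * sqrtC n%:R) ^+ 2 by rewrite E1.
  rewrite sqrtCK => Em.
  rewrite !(rmorphB, rmorphM, rmorphXn) /= !ratr_nat Em -[in X in _ - X](sqrtCK (n%:R : algC)); ring.
have [uw0|uw0] := eqVneq (u * w) 0; last first.
  have uw2 : 2 * u * w != 0 by rewrite -mulrA mulf_neq0 ?pnatr_eq0.
  pose q := (m%:R - u ^+ 2 - w ^+ 2 * n%:R) / (2 * u * w).
  have Dq : ratr q = sqrtC (n%:R : algC).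
    by rewrite /q fmorph_div /= E2 mulrC mulKf // fmorph_eq0.
  have := squarefree_Nsqr q sn n1; move/eqP; apply.
  by apply: (fmorph_inj (ratr : rat -> algC)); rewrite rmorphXn /= Dq sqrtCK ratr_nat.
move: E2; rewrite -mulrA uw0 mulr0 rmorph0 mul0r => /eqP; rewrite fmorph_eq0 subr_eq0 => /eqP E2.
move/eqP: uw0; rewrite mulf_eq0 => /orP[]/eqP e0; move: E2; rewrite e0.
  rewrite expr0n subr0 => E2; move: (mn w); rewrite E2 mulrC; by rewrite eqxx.
rewrite expr0n mul0r => /eqP; rewrite subr_eq0 => /eqP E2.
by have := squarefree_Nsqr u sm m1; rewrite E2 eqxx.
Qed.

Lemma unitO_sub (F F' : fld) u : (forall z, F z -> F' z) -> unitO F u -> unitO F' u.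
Proof. by move=> FF' [[Fu Zu] [u0 [FV ZV]]]; split; [split; auto | split=> //; split; auto]. Qed.

Section UnitTheory.
Variable F : fld.
Hypothesis FF : subfield F.

Lemma unitO1 : unitO F 1.
Proof. by split; [|split]; rewrite ?invr1 ?oner_neq0 //; split=> //; apply: subfield1. Qed.

Lemma unitOM u v : unitO F u -> unitO F v -> unitO F (u * v).
Proof.
move=> [[Fu Zu] [u0 [FuV ZuV]]] [[Fv Zv] [v0 [FvV ZvV]]].
split; first by split; [apply: subfieldM | apply: rpredM].
split; first by rewrite mulf_neq0.
by rewrite invfM; split; [apply: subfieldM | apply: rpredM].
Qed.

Lemma unitOV u : unitO F u -> unitO F u^-1.
Proof. by move=> [Hu [u0 HV]]; split=> //; rewrite invrK invr_eq0. Qed.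

Lemma unitON u : unitO F u -> unitO F (- u).
Proof.
move=> [[Fu Zu] [u0 [FuV ZuV]]]; split; first by split; [apply: subfieldN | rewrite rpredN].
rewrite oppr_eq0; split=> //; rewrite invrN.
by split; [apply: subfieldN | rewrite rpredN].
Qed.

Lemma unitOX u n : unitO F u -> unitO F (u ^+ n).
Proof.
move=> Uu; elim: n => [|n IHn]; first exact: unitO1.
by rewrite exprS; apply: unitOM.
Qed.

Lemma unitOXz u (n : int) : unitO F u -> unitO F (u ^ n).
Proof.
by move=> Uu; case: n => n; [exact: unitOX | exact: (unitOV (unitOX n.+1 Uu))].
Qed.

Lemma unitO_sqr u : F u -> unitO F (u ^+ 2) -> unitO F u.
Proof.
move=> Fu [[_ Z2] [u20 [_ ZV2]]]; split; first by split=> //; apply: Aint_sqr.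
split; first by apply: contraNneq u20 => ->; rewrite expr0n.
by split; [apply: subfieldV | apply: Aint_sqr; rewrite exprVn].
Qed.

Lemma unitO_inv_Aint u : F u -> u \in Aint -> u != 0 -> u^-1 \in Aint -> unitO F u.
Proof. by move=> Fu Zu u0 ZV; split=> //; split=> //; split=> //; apply: subfieldV. Qed.

End UnitTheory.

Lemma Aint_ratr (q : rat) : ratr q \in Aint -> q \in Num.int.
Proof.
move=> Zq; have /intrP[n Dn] := Cint_rat_Aint (Crat_rat q) Zq.
by apply/intrP; exists n; apply: (fmorph_inj (ratr : rat -> algC)); rewrite /= Dn ratr_int.
Qed.

(** The trace is 2 u, and trace and norm together make m (2 v)^2 an integer, with m squarefree. The
    sign [b] covers real and imaginary fields alike. *)
Lemma quadratic_half_int (X : algC) (m : nat) (b : bool) (u v : rat) :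
  squarefree m -> X ^+ 2 = (-1) ^+ b * m%:R ->
  ratr u + ratr v * X \in Aint -> ratr u - ratr v * X \in Aint ->
  2 * u \in Num.int /\ 2 * v \in Num.int.
Proof.
move=> sm X2 Z1 Z2; have u2 : 2 * u \in Num.int.
  apply: Aint_ratr; rewrite rmorphM /= ratr_nat.
  have -> : 2 * ratr u = (ratr u + ratr v * X) + (ratr u - ratr v * X) :> algC by ring.
  exact: rpredD.
split=> //; apply: (squarefree_ratint sm).
have N1 : u ^+ 2 - (-1) ^+ b * m%:R * v ^+ 2 \in Num.int.
  apply: Aint_ratr; rewrite (_ : ratr _ = (ratr u + ratr v * X) * (ratr u - ratr v * X)) ?rpredM //.
  rewrite !(rmorphB, rmorphM, rmorphXn) /= ratr_nat rmorphN1 -X2; ring.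
have -> : m%:R * (2 * v) ^+ 2 =
    (-1) ^+ b * ((2 * u) ^+ 2 - 4 * (u ^+ 2 - (-1) ^+ b * m%:R * v ^+ 2)).
  by case: b {X2 N1}; rewrite ?expr1 ?expr0; ring.
by rewrite rpredM ?rpred_sign // rpredB ?rpredX // rpredM ?rpred_nat.
Qed.

Lemma Nint_half (q : rat) : 2 * q \in Num.int -> exists n : int, q = n%:~R / 2.
Proof. by move=> /intrP[n Dn]; exists n; rewrite -Dn mulrAC divff ?mul1r // pnatr_eq0. Qed.

(** Doubling the coordinates gives x^2 + m y^2 = 4, and m >= 5 leaves only y = 0; m = 3 would admit
    sixth roots of unity. *)
Lemma unit_imaginary (m : nat) (z : algC) (u v : rat) : squarefree m -> (5 <= m)%N ->
  z = ratr u + ratr v * ('i * sqrtC m%:R) -> z \in Aint -> z * z^* = 1 -> z ^+ 2 = 1.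
Proof.
move=> sm m5 Dz Zz zz1.
have conjz : z^* = ratr u - ratr v * ('i * sqrtC m%:R).
  by rewrite Dz conjC_lin !ratr_conj conjCM conj_i conj_sqrt mulNr mulrN.
have iX : ('i * sqrtC (m%:R : algC)) ^+ 2 = (-1) ^+ true * m%:R.
  by rewrite exprMn sqrCi sqrtCK.
have Zz' : z^* \in Aint by rewrite Aint_aut.
move: (Zz) (Zz'); rewrite conjz Dz => /(quadratic_half_int sm iX) H /H [].
move=> /Nint_half[x Dx] /Nint_half[y Dy].
have E : u ^+ 2 + m%:R * v ^+ 2 = 1.
  apply: (fmorph_inj (ratr : rat -> algC)); rewrite rmorph1 -zz1 conjz {1}Dz.
  rewrite !(rmorphD, rmorphXn, rmorphM) /= ratr_nat.
  transitivity (ratr u ^+ 2 - ratr v ^+ 2 * ('i * sqrtC (m%:R : algC)) ^+ 2); last by ring.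
  by rewrite iX; ring.
have {}E : x ^+ 2 + m%:R * y ^+ 2 = 4.
  apply: (@intr_inj rat); rewrite !(rmorphD, rmorphXn, rmorphM) /= !rmorph_nat.
  transitivity (4 * (u ^+ 2 + m%:R * v ^+ 2)); last by rewrite E mulr1.
  by rewrite Dx Dy; field.
have y0 : y = 0 by move: E; rewrite natz; nia.
have x4 : x ^+ 2 = 4 by rewrite -E y0 expr0n mulr0 addr0.
rewrite Dy y0 mul0r rmorph0 mul0r addr0 Dx -rmorphXn /=.
by rewrite expr_div_n -rmorphXn /= x4 (_ : _ / _ = 1) ?rmorph1 //; field.
Qed.

Lemma unit_gaussian (z : algC) (u v : rat) :
  z = ratr u + ratr v * 'i -> z \in Aint -> z * z^* = 1 -> z ^+ 4 = 1.
Proof.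
move=> Dz Zz zz1.
have conjz : z^* = ratr u - ratr v * 'i.
  by rewrite Dz conjC_lin !ratr_conj conj_i mulrN.
have iX : ('i : algC) ^+ 2 = (-1) ^+ true * 1%:R by rewrite sqrCi mulr1.
have Zz' : z^* \in Aint by rewrite Aint_aut.
move: (Zz) (Zz'); rewrite conjz Dz => /(quadratic_half_int squarefree1 iX) H /H [].
move=> /Nint_half[x Dx] /Nint_half[y Dy].
have E : u ^+ 2 + v ^+ 2 = 1.
  apply: (fmorph_inj (ratr : rat -> algC)); rewrite rmorph1 -zz1 conjz {1}Dz.
  rewrite rmorphD !rmorphXn /=.
  transitivity (ratr u ^+ 2 - ratr v ^+ 2 * ('i : algC) ^+ 2); last by ring.
  by rewrite iX; ring.
have Exy : x ^+ 2 + y ^+ 2 = 4.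
  apply: (@intr_inj rat); rewrite rmorphD /= !rmorphXn /=.
  transitivity (4 * (u ^+ 2 + v ^+ 2)); last by rewrite E mulr1.
  by rewrite Dx Dy; field.
have xy0 : x * y = 0.
  have : (`|x| = 0 \/ `|x| = 1 \/ `|x| = 2 :> int) by nia.
  have : (`|y| = 0 \/ `|y| = 1 \/ `|y| = 2 :> int) by nia.
  by case=> [?|[?|?]]; case=> [?|[?|?]]; nia.
have uv0 : u * v = 0 by rewrite Dx Dy mulrACA -rmorphM /= xy0 mul0r.
have z2 : z ^+ 2 = ratr (u ^+ 2 - v ^+ 2).
  rewrite Dz rmorphB !rmorphXn /=.
  transitivity (ratr u ^+ 2 + ratr v ^+ 2 * ('i : algC) ^+ 2 + 2 * (ratr u * ratr v) * 'i).
    by ring.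
  by rewrite -rmorphM uv0 rmorph0 mulr0 mul0r addr0 sqrCi; ring.
rewrite -Dz (exprM z 2 2) z2 -rmorphXn /=.
rewrite (_ : (_ - _) ^+ 2 = (u ^+ 2 + v ^+ 2) ^+ 2 - 4 * (u * v) ^+ 2); last by ring.
by rewrite uv0 E expr1n expr0n mulr0 subr0 rmorph1.
Qed.

(** X is even because m is, and then m = 2 (mod 4) forces Y to be even. Half-integral coordinates of
    a unit are thus integral. *)
Lemma pell4_even (m : nat) (X Y : int) : ~~ odd m -> ~~ (4 %| m)%N ->
  X ^+ 2 = m%:Z * Y ^+ 2 + 4 -> exists x y, [/\ X = 2 * x, Y = 2 * y & x ^+ 2 = m%:Z * y ^+ 2 + 1].
Proof.
move=> em m4 E.
have [d Dd] : exists d, m = (2 * (2 * d + 1))%N by exists (m./2./2); lia.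
pose x := (X %/ 2)%Z; pose r := (X %% 2)%Z; pose y := (Y %/ 2)%Z; pose s := (Y %% 2)%Z.
have DX : X = 2 * x + r by rewrite /x /r; lia.
have DY : Y = 2 * y + s by rewrite /y /s; lia.
have r01 : r = 0 \/ r = 1 by rewrite /r; lia.
have s01 : s = 0 \/ s = 1 by rewrite /s; lia.
clearbody x r y s.
move: E; rewrite DX DY Dd => E.
have r0 : r = 0 by case: r01 => // r1; move: E; rewrite r1 !PoszM PoszD PoszM; nia.
have s0 : s = 0 by case: s01 => // s1; move: E; rewrite r0 s1 !PoszM PoszD PoszM; nia.
by exists x, y; split; rewrite ?r0 ?s0 ?addr0 //; move: E; rewrite r0 s0; nia.
Qed.

(** In (X + 2)(X - 2) = p Y^2 the factors are coprime when X is odd. When X is even, Y is even too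
    and halving both gives a Pell equation. *)
Lemma pell4_prime (p X Y : nat) : prime p -> (p %% 4 = 1)%N ->
  (X ^ 2 = p * Y ^ 2 + 4)%N ->
  exists d u, [/\ d = 1%N \/ d = p, (X + 2 = d * u ^ 2)%N & (0 < u)%N].
Proof.
move=> pp p4 E; have p0 := prime_gt0 pp.
have X2 : (2 <= X)%N by rewrite leqNgt; apply/negP => X2; case: X E X2 => [|[|]] //; lia.
have [d1 [d2 [a [DE Ha]]]] :
    exists d1 d2 a, (d1 * d2 = p)%N /\ (X + 2 = d1 * a ^ 2)%N; last first.
  exists d1, a; split=> //; last by case: a Ha => // Ha; lia.
  have : (d1 %| p)%N by rewrite -DE dvdn_mulr.
  by move/primeP: (pp) => [_ /[apply]] /orP[]/eqP ->; [left|right].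
have [oX|eX] := boolP (odd X).
  have co : coprime (X + 2) (X - 2).
    have [n Dn] : exists n, X = (n + 2)%N by exists (X - 2)%N; lia.
    rewrite Dn addnK -addnA /coprime gcdnC gcdnDl -/(coprime n (2 ^ 2)).
    by rewrite (coprimeXr 2 (_ : coprime n 2)) // coprimen2; move: oX; rewrite Dn; lia.
  have E2 : ((X + 2) * (X - 2) = p * Y ^ 2)%N.
    have [n Dn] : exists n, X = (n + 2)%N by exists (X - 2)%N; lia.
    by move: E; rewrite Dn addnK; lia.
  by have [d1 [d2 [a [b [? ? ?]]]]] := coprime_mul_sqr_fact p0 co E2; exists d1, d2, a.
have [x Dx] : exists x, X = (2 * x)%N by exists X./2; lia.
have [q Dq] : exists q, p = (4 * q + 1)%N by exists (p %/ 4)%N; lia.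
have [y Dy] : exists y, Y = (2 * y)%N.
  exists Y./2; have [l [s [Dl s1]]] : exists l s, Y = (2 * l + s)%N /\ (s <= 1)%N.
    by exists Y./2, (Y %% 2)%N; lia.
  suff : s = 0%N by lia.
  by case: s Dl s1 => [//|[|//]] Dl _; move: E; rewrite Dx Dl Dq; nia.
have E2 : (x ^ 2 = p * y ^ 2 + 1)%N by move: E; rewrite Dx Dy; lia.
have [ox oy] := pell_1mod4 p4 E2.
have [d1 [d2 [a [b [? Ha ? ?]]]]] := pell_even_split p0 E2 ox oy.
by exists d1, d2, (2 * a)%N; split=> //; rewrite Dx; lia.
Qed.

(** * Units of real quadratic fields *)

Section NormOneUnits.
Variables (m : nat) (u v : rat).
Hypothesis sm : squarefree m.
Local Notation C := (sqrtC (m%:R : algC)).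
Local Notation z := (ratr u + ratr v * C).
Local Notation z' := (ratr u - ratr v * C).
Hypotheses (z_gt0 : 0 < z) (Zz : z \in Aint) (Zz' : z' \in Aint) (N1 : z * z' = 1).

Lemma norm1_eq : u ^+ 2 = m%:R * v ^+ 2 + 1.
Proof.
apply: (fmorph_inj (ratr : rat -> algC)).
rewrite !(rmorphD, rmorphXn, rmorphM) /= ratr_nat rmorph1.
transitivity (C ^+ 2 * ratr v ^+ 2 + z * z'); first by ring.
by rewrite N1 sqrtCK.
Qed.

Lemma norm1_trace_gt0 : 0 < u.
Proof.
have z'_gt0 : 0 < z' by rewrite -(pmulr_rgt0 _ z_gt0) N1 ltr01.
have : 0 < ratr (2 * u) :> algC.
  rewrite rmorphM /= ratr_nat; have -> : 2 * ratr u = z + z' :> algC by ring.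
  exact: addr_gt0.
by rewrite ltr0q pmulr_rgt0.
Qed.

(** As z z' = 1, (z + 1)^2 = z (z + 2 + z'). So the square class of z in its field is that of 2 (u +
    1). *)
Lemma norm1_sqr : (z + 1) ^+ 2 = ratr (2 * (u + 1)) * z.
Proof.
rewrite rmorphM /= ratr_nat rmorphD /= rmorph1.
transitivity (z * z + 2 * z + z * z'); first by rewrite N1; ring.
by ring.
Qed.

Lemma norm1_int : exists X Y : int, [/\ u = X%:~R / 2, v = Y%:~R / 2, 0 < X & X ^+ 2 = m%:Z * Y ^+ 2 + 4].
Proof.
have C2 : C ^+ 2 = (-1) ^+ false * m%:R by rewrite sqrtCK mul1r.
have [/Nint_half[X DX] /Nint_half[Y DY]] := quadratic_half_int sm C2 Zz Zz'.
exists X, Y; split=> //.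
  by have := norm1_trace_gt0; rewrite DX pmulr_lgt0 ?invr_gt0 // ltr0z.
apply: (@intr_inj rat); rewrite !(rmorphD, rmorphXn, rmorphM) /=.
transitivity (4 * u ^+ 2); first by rewrite DX; field.
by rewrite norm1_eq DY -pmulrn; field.
Qed.

(** The square class 2 (x + 1) of z becomes d1 once x + 1 = 2 d1 a^2. *)
Lemma norm1_class_even : ~~ odd m ->
  exists (x : int) (d1 d2 a b : nat),
   [/\ u = x%:~R, (d1 * d2 = m)%N, x + 1 = (2 * d1 * a ^ 2)%N%:Z, x - 1 = (2 * d2 * b ^ 2)%N%:Z
     & d1%:R * z = ((z + 1) / (2 * a%:R)) ^+ 2].
Proof.
move=> em; have m4 : ~~ (4 %| m)%N by exact: (sm (isT : prime 2)).
have [X [Y [DX DY X0 EXY]]] := norm1_int.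
have [x [y [Dx Dy Exy]]] := pell4_even em m4 EXY.
have m0 : (0 < m)%N by case: (m) m4.
have x0 : 0 < x by lia.
have E : (`|x| ^ 2 = m * `|y| ^ 2 + 1)%N by lia.
have [ox oy] := pell_even em m4 E.
have [d1 [d2 [a [b [D12 Ha Hb Hy]]]]] := pell_even_split m0 E ox oy.
have Du : u = x%:~R by rewrite DX Dx rmorphM /=; field.
have Ex1 : x + 1 = (2 * d1 * a ^ 2)%N%:Z by clear - Ha x0; lia.
exists x, d1, d2, a, b; split=> //; first by clear - Hb x0 ox; lia.
have a0 : (a%:R : algC) != 0 by rewrite pnatr_eq0; case: a Ha {Ex1 Hy} => // ; lia.
rewrite expr_div_n norm1_sqr Du.
have -> : ratr (2 * (x%:~R + 1)) = 4 * d1%:R * a%:R ^+ 2 :> algC.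
  rewrite (_ : x%:~R + 1 = (2 * d1 * a ^ 2)%:R :> rat); last first.
    by rewrite -[1]/(1%:~R) -rmorphD /= Ex1 -pmulrn.
  by rewrite rmorphM /= !ratr_nat -mulnn !natrM; ring.
by field; rewrite a0.
Qed.

(** The square class of z is 1 or m, and m is a square in the field. *)
Lemma norm1_sqr_prime : prime m -> (m %% 4 = 1)%N ->
  exists2 w, Qsqrt m w & w ^+ 2 = z.
Proof.
move=> pm m4; have [X [Y [DX DY X0 EXY]]] := norm1_int.
have E : (`|X| ^ 2 = m * `|Y| ^ 2 + 4)%N by lia.
have [d [a [Hd Ha a_gt0]]] := pell4_prime pm m4 E.
have a0 : (a%:R : algC) != 0 by rewrite pnatr_eq0 -lt0n.
have S := Qsqrt_subfield m.
have Sz : Qsqrt m z by exists (ratr u), (ratr v); split; [exists u | split; [exists v|]].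
have Sw : Qsqrt m ((z + 1) / a%:R).
  apply: (subfieldM S); first exact: (subfieldD S Sz (subfield1 S)).
  exact/(subfieldV S)/(subfield_nat S).
have Dw : ((z + 1) / a%:R) ^+ 2 = d%:R * z.
  rewrite expr_div_n norm1_sqr DX.
  have -> : ratr (2 * (X%:~R / 2 + 1)) = d%:R * a%:R ^+ 2 :> algC.
    rewrite (_ : _ * _ = (d * a ^ 2)%:R :> rat); first by rewrite ratr_nat natrM natrX.
    have -> : 2 * (X%:~R / 2 + 1) = X%:~R + 2 :> rat by field.
    have DXn : X = `|X|%N%:Z by lia.
    by rewrite -Ha natrD {1}DXn -pmulrn.
  by field; rewrite a0.
case: Hd Dw => -> Dw; first by exists ((z + 1) / a%:R); rewrite ?Dw ?mul1r.
have C0 : C != 0 by rewrite sqrtC_nat_eq0 ?prime_gt0.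
exists ((z + 1) / a%:R / C).
  apply: (subfieldM S) => //; apply: (subfieldV S); apply: adj_gen; exact: Qf_subfield.
by rewrite expr_div_n Dw sqrtCK mulrC mulKf // -sqrtC_eq0.
Qed.
End NormOneUnits.

Section FundamentalUnit.
Variables (m : nat) (e : algC).
Hypothesis fe : fund_unit m e.

(** Divided by the largest power of e not exceeding it, a unit w >= 1 falls in [1, e), so the
    quotient is 1 by minimality of e. Units below 1 are inverted. *)
Lemma fund_unit_pow z : unitO (Qsqrt m) z -> 0 < z -> exists n : int, z = e ^ n.
Proof.
have [Ue e_gt1 e_min] := fe; have S := Qsqrt_subfield m.
have e_gt0 : 0 < e := lt_trans ltr01 e_gt1.
have e0 : e != 0 := lt0r_neq0 e_gt0.
have pow1 w : unitO (Qsqrt m) w -> 1 <= w -> exists n : nat, w = e ^+ n.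
  move=> Uw w1; have w0 : 0 <= w := le_trans ler01 w1.
  have unbounded : exists n, w < e ^+ n.
    have e1 : 0 < e - 1 by rewrite subr_gt0.
    exists (Num.bound (w / (e - 1))).
    have := archi_boundP (divr_ge0 w0 (ltW e1)); set n := Num.bound _.
    rewrite ltr_pdivrMr // => /lt_trans; apply.
    (* A form of Bernoulli's inequality: n (e - 1) < e^n. *)
    elim: (n) => [|j IHj]; first by rewrite mul0r expr0 ltr01.
    rewrite exprS; apply: (@lt_le_trans _ _ (e ^+ j + (e - 1))).
      by rewrite -natr1 mulrDl mul1r ltrD2r.
    rewrite -subr_ge0 (_ : _ - _ = (e - 1) * (e ^+ j - 1)); last by ring.
    apply: mulr_ge0; [exact: ltW | by rewrite subr_ge0 exprn_ege1 // ltW].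
  case: (ex_minnP unbounded) => [[|n]]; first by rewrite expr0 => /(le_lt_trans w1); rewrite ltxx.
  move=> w_lt n_min; exists n.
  have en0 : 0 < e ^+ n by rewrite exprn_gt0.
  have wr : w \is Num.real by rewrite ger0_real.
  have enr : e ^+ n \is Num.real by rewrite gtr0_real.
  have en_le : e ^+ n <= w.
    by case: (real_leP enr wr) => // /n_min; rewrite ltnn.
  apply/eqP; rewrite eq_sym -subr_eq0; apply/negPn/negP => ne.
  have lt_w : e ^+ n < w by rewrite lt_def en_le andbT eq_sym -subr_eq0.
  have := e_min (w / e ^+ n).
  rewrite ltr_pdivlMr // mul1r ler_pdivlMr // -exprS => /(_ _ lt_w)/wrap[].
    by apply: (unitOM S) => //; apply: (unitOV); exact: unitOX.
  by move=> /le_lt_trans /(_ w_lt); rewrite ltxx.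
move=> Uz z_gt0; have z0 := lt0r_neq0 z_gt0.
have zr : z \is Num.real by rewrite gtr0_real.
case: (real_leP (real1 _) zr) => [z1|z1]; first by have [n ->] := pow1 _ Uz z1; exists n.
have [||n Dn] := pow1 z^-1; first exact: unitOV.
  by rewrite -[leLHS]invr1 lef_pV2 ?posrE ?ltr01 ?ltW.
by exists (- n%:Z); rewrite -[z]invrK Dn exprnN.
Qed.

Lemma fund_unit_sqclass z : unitO (Qsqrt m) z -> 0 < z ->
  exists2 t, unitO (Qsqrt m) t & z = t ^+ 2 \/ z = e * t ^+ 2.
Proof.
have [Ue e_gt1 e_min] := fe; have S := Qsqrt_subfield m.
have e0 : e != 0 := lt0r_neq0 (lt_trans ltr01 e_gt1).
move=> Uz /(fund_unit_pow Uz)[n Dn].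
have Ut := unitOXz S (n %/ 2)%Z Ue; exists (e ^ (n %/ 2)%Z) => //.
have : n = (n %/ 2)%Z + (n %/ 2)%Z \/ n = 1 + ((n %/ 2)%Z + (n %/ 2)%Z) by lia.
rewrite Dn expr2 => -[E|E]; [left|right]; first by rewrite -expfzDr // -E.
by rewrite {1}E !expfzDr // expr1z.
Qed.

Lemma fund_unit_norm1 (nu : {rmorphism algC -> algC}) z :
  e * nu e = 1 -> unitO (Qsqrt m) z -> 0 < z -> z * nu z = 1.
Proof.
move=> Ne Uz /(fund_unit_pow Uz)[n ->].
by rewrite fmorphXz -expfzMl Ne exp1rz.
Qed.
End FundamentalUnit.

(** * The field K1 *)

Section Multiquadratic.
Variables (p1 p2 : nat).
Hypotheses (pr1 : prime p1) (pr2 : prime p2) (p1_4 : (p1 %% 4 = 1)%N) (p2_4 : (p2 %% 4 = 1)%N).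
Hypothesis p1Np2 : p1 != p2.

Local Notation A := (sqrtC (p1%:R : algC)).
Local Notation B := (sqrtC ((2 * p2)%:R : algC)).
Local Notation D := (sqrtC ((2 * p1 * p2)%:R : algC)).
Local Notation k := (adj (Qsqrt (2 * p1 * p2)) 'i).
Local Notation K := (adj k A).

Lemma sqrtAB : A * B = D.
Proof. by rewrite -rootCMl ?ler0n // -natrM; congr (sqrtC _%:R); lia. Qed.

Lemma two_ndvd_p2 : ~~ (2 %| p2)%N. Proof. by lia. Qed.

Lemma squarefree_2p2 : squarefree (2 * p2).
Proof. by apply: squarefree_prime_mul => //; [exact: two_ndvd_p2 | exact: squarefree_prime]. Qed.

Lemma squarefree_d : squarefree (2 * p1 * p2).
Proof.
rewrite (_ : (2 * p1 * p2 = p1 * (2 * p2))%N); last by lia.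
apply: squarefree_prime_mul => //; last exact: squarefree_2p2.
rewrite Euclid_dvdM // !dvdn_prime2 // negb_or p1Np2 andbT.
by apply/eqP => e; move: p1_4; rewrite e.
Qed.

Lemma p1_ge5 : (5 <= p1)%N.
Proof. by have := prime_gt1 pr1; move: p1_4; case: p1 => [|[|[|[|[|]]]]]. Qed.
Lemma p2_ge5 : (5 <= p2)%N.
Proof. by have := prime_gt1 pr2; move: p2_4; case: p2 => [|[|[|[|[|]]]]]. Qed.

Lemma sqrA : A ^+ 2 = p1%:R. Proof. exact: sqrtCK. Qed.
Lemma sqrB : B ^+ 2 = (2 * p2)%:R. Proof. exact: sqrtCK. Qed.
Lemma sqrD : D ^+ 2 = (2 * p1 * p2)%:R. Proof. exact: sqrtCK. Qed.

Lemma A_neq0 : A != 0. Proof. by rewrite sqrtC_nat_eq0 ?prime_gt0. Qed.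
Lemma B_neq0 : B != 0. Proof. by apply: sqrtC_nat_eq0; have := prime_gt0 pr2; lia. Qed.

Lemma gt1_2p2 : (1 < 2 * p2)%N.
Proof. by have := prime_gt0 pr2; lia. Qed.

Lemma gt1_d : (1 < 2 * p1 * p2)%N.
Proof. by have := prime_gt0 pr1; have := prime_gt0 pr2; nia. Qed.

Lemma d_ge5 : (5 <= 2 * p1 * p2)%N.
Proof. by have := p1_ge5; have := prime_gt0 pr2; clear; nia. Qed.

Lemma p1_mul_2p2 : (2 * p1 * p2 = p1 * (2 * p2))%N.
Proof. by lia. Qed.

(** Together with complex conjugation these two generate the Galois group of K over Q, of order
    8. *)
Lemma galois_exists : exists sg ss : {rmorphism algC -> algC},
  [/\ sg 'i = 'i, sg D = D & sg A = - A] /\ [/\ ss 'i = 'i, ss A = A & ss D = - D].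
Proof.
have i2 : ('i : algC) ^+ 2 = ratr (-1) by rewrite sqrCi rmorphN1.
have q2 n : sqrtC (n%:R : algC) ^+ 2 = ratr n%:R by rewrite sqrtCK ratr_nat.
have p0 : p1%:R != 0 :> rat by rewrite pnatr_eq0 -lt0n prime_gt0.
have [|sg Hsg] := biquadratic_aut i2 (q2 (2 * p1 * p2)%N) (q2 p1).
  apply: sqrt_notin; [exact: squarefree_prime | exact: prime_gt1 | exact: squarefree_d | exact: gt1_d |].
  move=> q; apply/eqP => E.
  move/eqP: (squarefree_Nsqr (q * (2 * p2)%:R) squarefree_2p2 gt1_2p2); apply.
  have E' : (1 : rat) = (2 * p2)%:R * q ^+ 2.
    by apply: (mulfI p0); rewrite mulr1 {1}E [RHS]mulrA -natrM p1_mul_2p2.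
  by rewrite exprMn [X in _ * X]expr2 mulrA [q ^+ 2 * _]mulrC -E' mul1r.
have [|ss Hss] := biquadratic_aut i2 (q2 p1) (q2 (2 * p1 * p2)%N).
  apply: sqrt_notin; [exact: squarefree_d | exact: gt1_d | exact: squarefree_prime | exact: prime_gt1 |].
  move=> q; apply/eqP => E.
  move/eqP: (squarefree_Nsqr q squarefree_2p2 gt1_2p2); apply.
  by apply: (mulfI p0); rewrite -E -natrM p1_mul_2p2.
by exists sg, ss.
Qed.

Lemma k_subfield : subfield k.
Proof.
apply: adj_subfield; first exact: Qsqrt_subfield.
by rewrite sqrCi; apply: (subfield_int (Qsqrt_subfield _) (-1)).
Qed.

Lemma k_sub_K z : k z -> K z. Proof. by apply: adj_sub; exact: k_subfield. Qed.

Lemma K_subfield : subfield K.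
Proof.
apply: adj_subfield; first exact: k_subfield.
by rewrite sqrA; exact: (subfield_nat k_subfield).
Qed.

Lemma k_i : k 'i. Proof. apply: adj_gen; exact: Qsqrt_subfield. Qed.
Lemma Qsqrt_sub_k z : Qsqrt (2 * p1 * p2) z -> k z.
Proof. by apply: adj_sub; exact: Qsqrt_subfield. Qed.
Lemma k_D : k D. Proof. by apply: Qsqrt_sub_k; apply: adj_gen; exact: Qf_subfield. Qed.
Lemma K_A : K A. Proof. apply: adj_gen; exact: k_subfield. Qed.
Lemma K_i : K 'i. Proof. exact: k_sub_K k_i. Qed.
Lemma K_D : K D. Proof. exact: k_sub_K k_D. Qed.
Lemma K_B : K B.
Proof.
have -> : B = D / A by rewrite -sqrtAB mulrC mulKf // A_neq0.
exact: (subfieldM K_subfield K_D (subfieldV K_subfield K_A)).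
Qed.

Lemma K_basis z : K z -> exists a, z = basis_sum 'i A D a.
Proof.
by case=> _ [_ [[_ [_ [[_ [_ [[a0 ->] [[a1 ->] ->]]]] [[_ [_ [[a2 ->] [[a3 ->] ->]]]] ->]]]]
  [[_ [_ [[_ [_ [[a4 ->] [[a5 ->] ->]]]] [[_ [_ [[a6 ->] [[a7 ->] ->]]]] ->]]]] ->]]];
 exists (nth 0 [:: a0; a1; a2; a3; a4; a5; a6; a7]).
Qed.

Section Automorphisms.
Variables sg ss : {rmorphism algC -> algC}.
Hypotheses (sg_i : sg 'i = 'i) (sgD : sg D = D) (sgA : sg A = - A).
Hypotheses (ss_i : ss 'i = 'i) (ssA : ss A = A) (ssD : ss D = - D).

Lemma sgB : sg B = - B.
Proof.
have : sg (A * B) = A * B by rewrite sqrtAB.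
by rewrite rmorphM /= sgA mulNr => E; apply: (mulfI A_neq0); rewrite mulrN -E opprK.
Qed.

Lemma sgK z : K z -> sg (sg z) = z.
Proof. move=> /K_basis[a ->]; rewrite !(aut_basis_sum, sg_i, sgA, sgD, rmorphN). by rewrite opprK. Qed.

Lemma ssK z : K z -> ss (ss z) = z.
Proof. by move=> /K_basis[a ->]; rewrite !(aut_basis_sum, ss_i, ssA, ssD, rmorphN) opprK. Qed.

Lemma sg_ss z : K z -> sg (ss z) = ss (sg z).
Proof.
by move=> /K_basis[a ->]; rewrite !(aut_basis_sum, ss_i, ssA, ssD, sg_i, sgA, sgD, rmorphN).
Qed.

Let autE := (conj_basis_sum, aut_basis_sum, conj_i, conj_sqrt, ss_i, ssA, ssD, sg_i, sgA, sgD, conjCN, rmorphN).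

Lemma sg_conj z : K z -> sg (z^* ) = (sg z)^*.
Proof. by move=> /K_basis[a ->]; rewrite !autE. Qed.

Lemma ss_conj z : K z -> ss (z^* ) = (ss z)^*.
Proof. by move=> /K_basis[a ->]; rewrite !autE. Qed.

Lemma DA : D * A = p1%:R * B.
Proof. by rewrite -sqrtAB mulrAC -expr2 sqrA. Qed.

(** * Quadratic subfields as fixed fields *)

Lemma fixed_ss_conj z : K z -> ss z = z -> z^* = z ->
  exists a b : rat, z = ratr a + ratr b * A.
Proof.
move=> /K_basis[a Dz] E1 E2; exists (a 0%N), (a 4%N).
have E3 : ss (z^* ) = z by rewrite E2.
by apply: (average4 E1 E2 E3); rewrite Dz !autE /basis_sum; ring.
Qed.

Lemma fixed_sgss_conj z : K z -> sg (ss z) = z -> z^* = z ->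
  exists a b : rat, z = ratr a + ratr b * B.
Proof.
(* Coordinate 5 is that of D A = p1 B, whence the factor p1. *)
move=> /K_basis[a Dz] E1 E2; exists (a 0%N), (a 5%N * p1%:R).
have E3 : sg (ss (z^* )) = z by rewrite E2.
rewrite ratr_mul_nat -mulrA -DA.
by apply: (average4 E1 E2 E3); rewrite Dz !autE /basis_sum; ring.
Qed.

Lemma fixed_sg_conj z : K z -> sg z = z -> z^* = z ->
  exists a b : rat, z = ratr a + ratr b * D.
Proof.
move=> /K_basis[a Dz] E1 E2; exists (a 0%N), (a 1%N).
have E3 : sg (z^* ) = z by rewrite E2.
by apply: (average4 E1 E2 E3); rewrite Dz !autE /basis_sum; ring.
Qed.

Lemma fixed_sg_ss z : K z -> sg z = z -> ss z = z ->
  exists a b : rat, z = ratr a + ratr b * 'i.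
Proof.
move=> /K_basis[a Dz] E1 E2; exists (a 0%N), (a 2%N).
have E3 : sg (ss z) = z by rewrite E2.
by apply: (average4 E1 E2 E3); rewrite Dz !autE /basis_sum; ring.
Qed.

Lemma fixed_ss_sgconj z : K z -> ss z = z -> sg (z^* ) = z ->
  exists a b : rat, z = ratr a + ratr b * ('i * A).
Proof.
move=> /K_basis[a Dz] E1 E2; exists (a 0%N), (a 6%N).
have E3 : ss (sg (z^* )) = z by rewrite E2.
by apply: (average4 E1 E2 E3); rewrite Dz !autE /basis_sum; ring.
Qed.

Lemma fixed_sgss_sgconj z : K z -> sg (ss z) = z -> sg (z^* ) = z ->
  exists a b : rat, z = ratr a + ratr b * ('i * B).
Proof.
move=> /K_basis[a Dz] E1 E2; exists (a 0%N), (a 7%N * p1%:R).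
have E3 : sg (ss (sg (z^* ))) = z by rewrite E2.
rewrite ratr_mul_nat -mulrA [p1%:R * _]mulrCA -DA.
by apply: (average4 E1 E2 E3); rewrite Dz !autE ?opprK /basis_sum; ring.
Qed.

Lemma fixed_sg_ssconj z : K z -> sg z = z -> ss (z^* ) = z ->
  exists a b : rat, z = ratr a + ratr b * ('i * D).
Proof.
move=> /K_basis[a Dz] E1 E2; exists (a 0%N), (a 3%N).
have E3 : sg (ss (z^* )) = z by rewrite E2.
by apply: (average4 E1 E2 E3); rewrite Dz !autE /basis_sum; ring.
Qed.

Lemma k_fixed z : k z -> sg z = z.
Proof.
move=> [_ [_ [[_ [_ [[a0 ->] [[a1 ->] ->]]]] [[_ [_ [[a2 ->] [[a3 ->] ->]]]] ->]]]].
by rewrite !(aut_lin, fmorph_rat, sgD, sg_i).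
Qed.

Lemma fixed_k z : K z -> sg z = z -> k z.
Proof.
move=> [u [v [ku [kv ->]]]].
rewrite aut_lin sgA !k_fixed // mulrN => /eqP.
rewrite -subr_eq0 opprD addrACA subrr add0r -opprD oppr_eq0 -mulr2n mulrn_eq0 /= => /eqP ->.
by rewrite addr0.
Qed.

Lemma K_sg z : K z -> K (sg z).
Proof.
move=> [u [v [ku [kv ->]]]]; rewrite aut_lin sgA !k_fixed //.
exists u, (- v); do 2?split => //; first exact: (subfieldN k_subfield).
by rewrite mulrN mulNr.
Qed.

Lemma k_ss z : k z -> k (ss z).
Proof.
move=> [_ [_ [[a [b [[a0 ->] [[a1 ->] ->]]]] [[c [e [[a2 ->] [[a3 ->] ->]]]] ->]]]].
rewrite !(aut_lin, fmorph_rat, ssD, ss_i).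
have S := k_subfield; have h1 := k_D; have h2 := k_i; have r := subfield_rat S.
by apply: (subfieldD S); [|apply: (subfieldM S) => //];
   apply: (subfieldD S) => //; apply: (subfieldM S) => //; apply: (subfieldN S).
Qed.

Lemma K_ss z : K z -> K (ss z).
Proof.
move=> [u [v [ku [kv ->]]]]; rewrite aut_lin ssA.
by exists (ss u), (ss v); do 2?split => //; exact: k_ss.
Qed.

Lemma K_conj z : K z -> K z^*.
Proof.
move=> /K_basis[a ->]; rewrite !autE /basis_sum.
have S := K_subfield; have h1 := K_D; have h2 := K_i; have h3 := K_A; have r := subfield_rat S.
by do ![exact: r | done | apply: (subfieldD S) | apply: (subfieldM S) | apply: (subfieldN S)].
Qed.

Local Notation U := (unitO K).

Lemma U_ss u : U u -> U (ss u).
Proof.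
move=> [[Ku Zu] [u0 [KV ZV]]]; split; first by split; [apply: K_ss | rewrite Aint_aut].
by rewrite fmorph_eq0 -fmorphV; split=> //; split; [apply: K_ss | rewrite Aint_aut].
Qed.

Lemma U_conj u : U u -> U u^*.
Proof.
move=> [[Ku Zu] [u0 [KV ZV]]]; split; first by split; [apply: K_conj | rewrite Aint_aut].
by rewrite fmorph_eq0 -fmorphV; split=> //; split; [apply: K_conj | rewrite Aint_aut].
Qed.

Lemma U_i : U 'i.
Proof.
apply: (unitO_sqr K_subfield K_i); rewrite sqrCi.
exact/(unitON K_subfield)/(unitO1 K_subfield).
Qed.

Lemma UM u v : U u -> U v -> U (u * v). Proof. exact: (unitOM K_subfield). Qed.
Lemma U_div u v : U u -> U v -> U (u / v).
Proof. by move=> Uu Uv; apply: UM => //; apply: unitOV. Qed.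

Lemma fixed_all z : K z -> sg z = z -> ss z = z -> z^* = z -> exists q : rat, z = ratr q.
Proof.
move=> Kz E1 E2 E3; have [a [b Dz]] := fixed_ss_conj Kz E2 E3; exists a.
move: E1; rewrite Dz aut_lin sgA !fmorph_rat mulrN => /addrI /eqP.
rewrite -subr_eq0 -opprD oppr_eq0 -mulr2n mulrn_eq0 /= => /eqP ->.
by rewrite addr0.
Qed.

Lemma sqr_sign (x y : algC) : x ^+ 2 = y ^+ 2 -> exists b : bool, x = (-1) ^+ b * y.
Proof.
move/eqP; rewrite eqf_sqr => /orP[]/eqP ->; first by exists false; rewrite mul1r.
by exists true; rewrite mulN1r.
Qed.

Lemma ratr_monomial (x y z : rat) a b c :
  ratr (2 * x ^+ a * y ^+ b * z ^+ c) = 2 * ratr x ^+ a * ratr y ^+ b * ratr z ^+ c :> algC.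
Proof. by rewrite !rmorphM !rmorphXn /= ratr_nat. Qed.

(** A Kummer argument: every automorphism multiplies a square root of 2 by a sign, and some monomial
    y in A, D, 'i has the same signs. The product z y is then rational, though its square, 2 y^2, is
    not a rational square. *)
Lemma sqrt2_notin_K z : K z -> z ^+ 2 != 2.
Proof.
move=> Kz; apply/eqP => z2.
have nu2 (nu : {rmorphism algC -> algC}) : exists b : bool, nu z = (-1) ^+ b * z.
  by apply: sqr_sign; rewrite -rmorphXn /= z2 rmorph_nat.
have [a Ea] := nu2 sg; have [b Eb] := nu2 ss; have [c Ec] := nu2 Num.conj.
pose y := A ^+ a * D ^+ b * 'i ^+ c.
have Ky : K y.
  by apply: (subfieldM K_subfield); first apply: (subfieldM K_subfield);
     apply: (subfieldX K_subfield); [exact: K_A | exact: K_D | exact: K_i].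
have S (d : bool) : (-1) ^+ d * (-1) ^+ d = 1 :> algC by rewrite -expr2 sqrr_sign.
have [q Dq] : exists q : rat, z * y = ratr q.
  apply: fixed_all; first exact: (subfieldM K_subfield).
  - rewrite rmorphM Ea /y aut_monomial sgA sgD sg_i [(- A) ^+ _]exprNn.
    by transitivity ((-1) ^+ a * (-1) ^+ a * (z * (A ^+ a * D ^+ b * 'i ^+ c))); [ring | rewrite S mul1r].
  - rewrite rmorphM Eb /y aut_monomial ssA ssD ss_i [(- D) ^+ _]exprNn.
    by transitivity ((-1) ^+ b * (-1) ^+ b * (z * (A ^+ a * D ^+ b * 'i ^+ c))); [ring | rewrite S mul1r].
  rewrite conjCM [z^*]Ec /y conjC_monomial !conj_sqrt conj_i [(- 'i) ^+ _]exprNn.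
  by transitivity ((-1) ^+ c * (-1) ^+ c * (z * (A ^+ a * D ^+ b * 'i ^+ c))); [ring | rewrite S mul1r].
have E : q ^+ 2 = 2 * p1%:R ^+ a * (2 * p1 * p2)%:R ^+ b * (-1) ^+ c.
  suff : ratr (q ^+ 2) = ratr (2 * p1%:R ^+ a * (2 * p1 * p2)%:R ^+ b * (-1) ^+ c) :> algC.
    exact: fmorph_inj.
  rewrite ratr_monomial !ratr_nat rmorphN1 rmorphXn /= -Dq /y.
  by rewrite 3!exprMn z2 ![_ ^+ _ ^+ 2]exprAC sqrA sqrD sqrCi !mulrA.
have p10 := prime_gt0 pr1; have p20 := prime_gt0 pr2.
have c0 : c = false.
  case: c E {Ec y Ky Dq} => // E; have := sqr_ge0 q; rewrite E expr1 mulrN1 oppr_ge0 => h.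
  have : 0 < 2 * p1%:R ^+ a * (2 * p1 * p2)%:R ^+ b :> rat.
    by rewrite !mulr_gt0 ?exprn_gt0 ?ltr0n ?muln_gt0 ?p10 ?p20.
  by rewrite ltNge h.
move: E; rewrite c0 expr0 mulr1 {c0 Ec y Ky Dq Ea Eb}.
have pp0 : (p1%:R : rat) != 0 by rewrite pnatr_eq0 -lt0n.
have sq2 : squarefree 2 by exact: squarefree_prime.
have sq2p1 : squarefree (2 * p1) by apply: squarefree_prime_mul => //; [lia | exact: squarefree_prime].
have sqp1p2 : squarefree (p1 * p2).
  apply: squarefree_prime_mul => //; last exact: squarefree_prime.
  by rewrite dvdn_prime2.
have lt1 : (1 < 2 * p1)%N /\ (1 < p1 * p2)%N by have := prime_gt1 pr1; nia.
(* The squarefree parts of the four possible values are p2, 2 p1, p1 p2 and 2. *)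
case: a; case: b; rewrite ?expr0 ?expr1 ?mulr1 => E.
- move/eqP: (squarefree_Nsqr (q / (2 * p1)%:R) (squarefree_prime pr2) (prime_gt1 pr2)).
  by apply; rewrite expr_div_n E !natrM; field.
- by have := squarefree_Nsqr q sq2p1 lt1.1; rewrite E natrM eqxx.
- move/eqP: (squarefree_Nsqr (q / 2) sqp1p2 lt1.2).
  by apply; rewrite expr_div_n E !natrM; field.
by have := squarefree_Nsqr q sq2 isT; rewrite E eqxx.
Qed.

Lemma mu4_sg w : w ^+ 4 = 1 -> sg w = w.
Proof.
move=> w4; have : (w - 1) * (w + 1) * ((w - 'i) * (w + 'i)) = 0.
  transitivity ((w ^+ 2 - 1) * (w ^+ 2 - 'i ^+ 2)); first by ring.
  by rewrite sqrCi; transitivity (w ^+ 4 - 1); [ring | rewrite w4 subrr].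
move/eqP; rewrite !mulf_eq0 !subr_eq0 !addr_eq0 -!orbA => /or4P[]/eqP ->;
  by rewrite ?rmorphN ?rmorph1 ?sg_i.
Qed.

Lemma sqr_1Di : (1 + 'i) ^+ 2 = 2 * 'i :> algC.
Proof.
transitivity (1 + 2 * 'i + ('i : algC) ^+ 2); first by ring.
by rewrite sqrCi; ring.
Qed.

(** If v^4 = 1 then v is a power of 'i, fixed by [sg]. If v^4 = -1 then (1 + 'i) v has square 2 or
    -2, and K would contain a square root of 2. *)
Lemma odd_not_mu8 v : K v -> sg v = - v -> v ^+ 8 != 1.
Proof.
move=> Kv sv; apply/eqP => v8.
have v0 : v != 0 by apply: contra_eq_neq v8 => ->; rewrite expr0n eq_sym oner_eq0.
have : (v ^+ 4) ^+ 2 == 1 by rewrite -exprM v8.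
rewrite sqrf_eq1 => /orP[]/eqP v4.
  have := mu4_sg v4; rewrite sv => /eqP; rewrite -subr_eq0 -opprD oppr_eq0.
  by rewrite -mulr2n mulrn_eq0 /= (negPf v0).
pose z := (1 + 'i) * v.
have Kz : K z.
  by apply: (subfieldM K_subfield) => //; apply: (subfieldD K_subfield (subfield1 K_subfield) K_i).
have : (z ^+ 2) ^+ 2 == 2 ^+ 2.
  have -> : z ^+ 2 = 2 * 'i * v ^+ 2 by rewrite /z exprMn sqr_1Di.
  apply/eqP; transitivity (4 * 'i ^+ 2 * v ^+ 4 : algC); first by ring.
  by rewrite sqrCi v4; ring.
rewrite eqf_sqr => /orP[]/eqP z2; first by have := sqrt2_notin_K Kz; rewrite z2 eqxx.
have := sqrt2_notin_K (subfieldM K_subfield K_i Kz).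
by rewrite exprMn sqrCi z2 mulN1r opprK eqxx.
Qed.

Lemma Qsqrt_sub_K m z : K (sqrtC m%:R) -> Qsqrt m z -> K z.
Proof.
move=> KC [_ [_ [[a ->] [[b ->] ->]]]]; have S := K_subfield.
exact: (subfieldD S (subfield_rat S a) (subfieldM S (subfield_rat S b) KC)).
Qed.

Lemma Qsqrt_real m z : Qsqrt m z -> z \is Num.real.
Proof.
move=> [_ [_ [[a ->] [[b ->] ->]]]].
by apply/CrealP; rewrite conjC_lin !ratr_conj conj_sqrt.
Qed.

Lemma pos_unit_A w : Qsqrt p1 w -> w \in Aint -> w * sg w = 1 -> 0 < w ->
  exists2 t, unitO (Qsqrt p1) t & w = t ^+ 2.
Proof.
move=> Qw Zw; have Zw' : sg w \in Aint by rewrite Aint_aut.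
case: (Qw) (Zw) Zw' => _ [_ [[a ->] [[b ->] Dw]]]; rewrite Dw.
rewrite aut_lin sgA !fmorph_rat mulrN => Z1 Z2 N1 pos.
have [t Qt Dt] := norm1_sqr_prime (squarefree_prime pr1) pos Z1 Z2 N1 pr1 p1_4.
exists t => //; apply: (unitO_sqr (Qsqrt_subfield p1) Qt); rewrite Dt.
apply: unitO_inv_Aint => //; first exact: Qsqrt_subfield.
- by rewrite -Dw.
- exact: lt0r_neq0.
by rewrite (mulr1_eq N1).
Qed.

Lemma divisors_2prime p d1 d2 : prime p -> (d1 * d2 = 2 * p)%N ->
  [\/ d1 = 1, d1 = 2, d1 = p | d1 = 2 * p]%N.
Proof.
move=> pp E; have p0 := prime_gt0 pp.
have d12 (x y : nat) : (x * y = 2)%N -> x = 1%N \/ x = 2%N.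
  move=> xy; have : (x %| 2)%N by rewrite -xy dvdn_mulr.
  by move/primeP: (isT : prime 2) => [_ /[apply]] /orP[]/eqP ->; [left|right].
have : (p %| d1 * d2)%N by rewrite E dvdn_mull.
rewrite Euclid_dvdM // => /orP[]/dvdnP[x Dx].
  have : (x * d2 = 2)%N by apply/eqP; rewrite -(eqn_pmul2r p0) -E Dx; apply/eqP; lia.
  by case/d12 => Ex; rewrite Dx Ex ?mul1n; [constructor 3 | constructor 4].
have : (d1 * x = 2)%N by apply/eqP; rewrite -(eqn_pmul2r p0) -E Dx; apply/eqP; lia.
by case/d12 => Ex; rewrite Ex; [constructor 1 | constructor 2].
Qed.

(** The prime p1 divides one factor, so the other one divides 2 p2. *)
Lemma divisors_d d1 d2 : (d1 * d2 = 2 * p1 * p2)%N ->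
  [\/ d1 = 1, d1 = 2, d1 = p2 | d1 = 2 * p2]%N \/
  [\/ d2 = 1, d2 = 2, d2 = p2 | d2 = 2 * p2]%N.
Proof.
move=> E; have p0 := prime_gt0 pr1.
have : (p1 %| d1 * d2)%N by rewrite E -mulnA mulnCA dvdn_mulr.
rewrite Euclid_dvdM // => /orP[]/dvdnP[x Dx]; [right|left].
  apply: (@divisors_2prime _ _ x) => //; apply/eqP.
  by rewrite -(eqn_pmul2r p0); apply/eqP; move: E; rewrite Dx; lia.
apply: (@divisors_2prime _ _ x) => //; apply/eqP.
by rewrite -(eqn_pmul2r p0); apply/eqP; move: E; rewrite Dx; lia.
Qed.

(** The square class of w is 1, 2, p2 or 2 p2; since 2 p2 = B^2, only 1 and 2 remain. *)
Lemma pos_unit_B w : Qsqrt (2 * p2) w -> w \in Aint -> w * sg w = 1 -> 0 < w ->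
  exists2 t, Qsqrt (2 * p2) t & w = t ^+ 2 \/ 2 * w = t ^+ 2.
Proof.
move=> Qw Zw; have Zw' : sg w \in Aint by rewrite Aint_aut.
case: (Qw) (Zw) Zw' => _ [_ [[a ->] [[b ->] Dw]]].
rewrite {1 2 3 4}Dw aut_lin sgB !fmorph_rat mulrN => Z1 Z2 N1; rewrite Dw => pos; rewrite -Dw.
have ev : ~~ odd (2 * p2) by rewrite oddM.
have [x [d1 [d2 [s [s' [_ D12 _ _]]]]]] := norm1_class_even squarefree_2p2 pos Z1 Z2 N1 ev.
rewrite -Dw; set t := (_ / _) => Dt.
have S := Qsqrt_subfield (2 * p2).
have Qt : Qsqrt (2 * p2) t.
  apply: (subfieldM S); first exact: (subfieldD S Qw (subfield1 S)).
  apply: (subfieldV S); apply: (subfieldM S); exact: (subfield_nat S).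
have QB : Qsqrt (2 * p2) B by apply: adj_gen; exact: Qf_subfield.
have p20 : (p2%:R : algC) != 0 by rewrite pnatr_eq0 -lt0n prime_gt0.
have [D1|D1|D1|D1] := divisors_2prime pr2 D12; move: Dt; rewrite D1 => Dt.
- by exists t => //; left; rewrite -Dt mul1r.
- by exists t => //; right; rewrite -Dt.
- exists (t * B / p2%:R).
    apply: (subfieldM S); first exact: (subfieldM S).
    exact/(subfieldV S)/(subfield_nat S).
  by right; rewrite expr_div_n exprMn -Dt sqrB natrM; field.
exists (t / B); first exact: (subfieldM S Qt (subfieldV S QB)).
left; rewrite expr_div_n -Dt sqrB mulrC mulKf //.
by rewrite -sqrB expf_neq0 // B_neq0.
Qed.

(** * Units of relative norm 1 *)

(** The subgroup generated by -1 and the coboundaries u / sg u. The sign is kept apart because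
    whether -1 is itself a coboundary decides between the two answers. *)
Definition signed_coboundary e := exists2 u, U u & e = u / sg u \/ e = - (u / sg u).

Lemma signed_coboundaryM e f :
  signed_coboundary e -> signed_coboundary f -> signed_coboundary (e * f).
Proof.
move=> [u Uu He] [v Uv Hf]; exists (u * v); first exact: UM.
have E : u * v / sg (u * v) = (u / sg u) * (v / sg v).
  by rewrite rmorphM invfM mulrACA.
by rewrite E; case: He => ->; case: Hf => ->; rewrite ?mulrNN ?mulrN ?mulNr; auto.
Qed.

Lemma signed_coboundaryN e : signed_coboundary e -> signed_coboundary (- e).
Proof. by move=> [u Uu He]; exists u => //; case: He => ->; rewrite ?opprK; auto. Qed.

(** One has u^2 = (u sg u)(u / sg u), and the first factor is a sign. *)
Lemma signed_coboundary_sqr u : U u -> (u * sg u) ^+ 2 = 1 -> signed_coboundary (u ^+ 2).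
Proof.
move=> Uu /eqP; have su0 : sg u != 0 by rewrite fmorph_eq0; case: Uu => _ [].
have E : u ^+ 2 = (u * sg u) * (u / sg u) by field.
rewrite sqrf_eq1 => /orP[]/eqP h; exists u => //; rewrite E h ?mul1r ?mulN1r; auto.
Qed.

Lemma real_unit_sign (F : fld) w : subfield F -> (forall z, F z -> z \is Num.real) ->
  F w -> w != 0 -> 0 < w \/ 0 < - w.
Proof.
move=> FF Fr Fw w0; rewrite oppr_gt0.
by case: (real_ltgtP (Fr _ Fw) (real0 _)) w0; auto.
Qed.

Lemma sg_mul_opp w : - w * sg (- w) = w * sg w.
Proof. by rewrite rmorphN mulrNN. Qed.

Lemma unitO_A_sub u : unitO (Qsqrt p1) u -> U u.
Proof. by apply: unitO_sub => z; apply: Qsqrt_sub_K; exact: K_A. Qed.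

Lemma unitO_B_sub u : unitO (Qsqrt (2 * p2)) u -> U u.
Proof. by apply: unitO_sub => z; apply: Qsqrt_sub_K; exact: K_B. Qed.

Lemma coboundary_A w : Qsqrt p1 w -> w \in Aint -> w * sg w = 1 -> signed_coboundary w.
Proof.
move=> Qw Zw N1.
have w0 : w != 0 by apply: contra_eq_neq N1 => ->; rewrite mul0r eq_sym oner_neq0.
wlog pos : w Qw Zw N1 w0 / 0 < w => [wlog|].
  have [pos|neg] := real_unit_sign (Qsqrt_subfield p1) (@Qsqrt_real _) Qw w0; first exact: wlog.
  rewrite -[w]opprK; apply: signed_coboundaryN; apply: wlog => //.
  - exact: (subfieldN (Qsqrt_subfield p1)).
  - by rewrite rpredN.
  - by rewrite sg_mul_opp.
  by rewrite oppr_eq0.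
have [t Ut Dt] := pos_unit_A Qw Zw N1 pos.
rewrite Dt; apply: signed_coboundary_sqr; first exact: unitO_A_sub.
by rewrite exprMn -rmorphXn -Dt.
Qed.

(** Since (1 + 'i)^2 = 2 'i, the quotient squares to w / 'i, a unit. *)
Lemma U_half_sqr t w : K t -> U w -> 2 * w = t ^+ 2 -> U (t / (1 + 'i)).
Proof.
move=> Kt Uw E; apply: (unitO_sqr K_subfield).
  apply: (subfieldM K_subfield) => //; apply: (subfieldV K_subfield).
  exact: (subfieldD K_subfield (subfield1 K_subfield) K_i).
rewrite expr_div_n -E sqr_1Di -mulf_div divff ?mul1r ?pnatr_eq0 //.
exact: U_div U_i.
Qed.

Lemma coboundary_B w : Qsqrt (2 * p2) w -> w \in Aint -> w * sg w = 1 -> signed_coboundary w.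
Proof.
move=> Qw Zw N1.
have w0 : w != 0 by apply: contra_eq_neq N1 => ->; rewrite mul0r eq_sym oner_neq0.
wlog pos : w Qw Zw N1 w0 / 0 < w => [wlog|].
  have [pos|neg] := real_unit_sign (Qsqrt_subfield _) (@Qsqrt_real _) Qw w0; first exact: wlog.
  rewrite -[w]opprK; apply: signed_coboundaryN; apply: wlog => //.
  - exact: (subfieldN (Qsqrt_subfield _)).
  - by rewrite rpredN.
  - by rewrite sg_mul_opp.
  by rewrite oppr_eq0.
have Uw : unitO (Qsqrt (2 * p2)) w.
  apply: unitO_inv_Aint => //; first exact: Qsqrt_subfield.
  by rewrite (mulr1_eq N1) Aint_aut.
have [t Qt [Dt|Dt]] := pos_unit_B Qw Zw N1 pos.
  rewrite Dt; apply: signed_coboundary_sqr.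
    apply: unitO_B_sub; apply: (unitO_sqr (Qsqrt_subfield _)) => //.
    by rewrite -Dt.
  by rewrite exprMn -rmorphXn -Dt.
have Kt := Qsqrt_sub_K K_B Qt.
have Ut := U_half_sqr Kt (unitO_B_sub Uw) Dt.
have t0 : t != 0.
  have : t ^+ 2 != 0 by rewrite -Dt mulf_neq0 // pnatr_eq0.
  by rewrite expf_eq0.
have st0 : sg t != 0 by rewrite fmorph_eq0.
have i0 : (1 + 'i : algC) != 0.
  have : (1 + 'i : algC) ^+ 2 != 0 by rewrite sqr_1Di mulf_neq0 ?pnatr_eq0 // neq0Ci.
  by rewrite expf_eq0.
(* From w = t^2 / 2; the divisor 1 + 'i is fixed by [sg] and cancels, and the first factor is a sign
   because w has norm 1. *)
have E : w = (t * sg t / 2) * ((t / (1 + 'i)) / sg (t / (1 + 'i))).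
  rewrite fmorph_div rmorphD rmorph1 sg_i.
  transitivity (t ^+ 2 / 2); first by rewrite -Dt mulrAC divff ?mul1r // pnatr_eq0.
  by field; rewrite i0 st0.
have : (t * sg t / 2) ^+ 2 == 1.
  rewrite expr_div_n exprMn -rmorphXn -Dt rmorphM rmorph_nat mulrACA N1 mulr1.
  by apply/eqP; field.
rewrite sqrf_eq1 => /orP[]/eqP h; exists (t / (1 + 'i)) => //; rewrite {1 2}E h ?mul1r ?mulN1r; auto.
Qed.

Section UpperBound.
Variable e2 : algC.
Hypotheses (fe2 : fund_unit (2 * p2) e2) (Ne2 : e2 * sg e2 = 1).

(** The hypothesis N(eps2) = 1 enters here: it excludes units of norm -1 from Q(B). *)
Lemma norm_B_unit w : unitO (Qsqrt (2 * p2)) w -> w * sg w = 1.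
Proof.
move=> Uw; have [[Qw _] [w0 _]] := Uw.
have [pos|neg] := real_unit_sign (Qsqrt_subfield _) (@Qsqrt_real _) Qw w0.
  exact: (fund_unit_norm1 fe2).
rewrite -sg_mul_opp; apply: (fund_unit_norm1 fe2) => //.
exact: (unitON (Qsqrt_subfield _)).
Qed.

(* e^2 is the product of the relative norms of e to Q(A) and Q(B): the part in
   Q(sqrt (2 p1 p2)) is a norm to k, hence 1. *)
Lemma real_coboundary e : U e -> e * sg e = 1 -> e^* = e -> signed_coboundary e.
Proof.
move=> Ue N1 ce; have [[Ke Ze] [e0 _]] := Ue.
pose h := e * ss e; pose t := e * sg (ss e).
have Kse := K_ss Ke; have KS := K_subfield.
have Kh : K h by apply: (subfieldM KS).
have Kt : K t by apply: (subfieldM KS) => //; apply: K_sg.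
have N1' : ss e * sg (ss e) = 1 by rewrite sg_ss // -rmorphM N1 rmorph1.
have De : e ^+ 2 = h * t by rewrite /h /t mulrACA N1' mulr1.
have Qh : Qsqrt p1 h.
  have [a [b ->]] : exists a b : rat, h = ratr a + ratr b * A.
    apply: fixed_ss_conj => //; first by rewrite rmorphM ssK // mulrC.
    by rewrite conjCM -ss_conj // ce.
  by exists (ratr a), (ratr b); split; [exists a | split; [exists b|]].
have Qt : Qsqrt (2 * p2) t.
  have [a [b ->]] : exists a b : rat, t = ratr a + ratr b * B.
    apply: fixed_sgss_conj => //.
      by rewrite !rmorphM /= -(sg_ss Kse) ssK // sgK // mulrC.
    by rewrite conjCM -sg_conj // -ss_conj // ce.
  by exists (ratr a), (ratr b); split; [exists a | split; [exists b|]].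
have Zh : h \in Aint by rewrite rpredM // Aint_aut.
have Zt : t \in Aint by rewrite rpredM // !Aint_aut.
have Nh : h * sg h = 1 by rewrite rmorphM mulrACA N1 N1' mulr1.
have Nt : t * sg t = 1 by rewrite rmorphM /= sgK // mulrACA N1 mul1r mulrC.
have h0 : h != 0 by apply: contra_eq_neq Nh => ->; rewrite mul0r eq_sym oner_neq0.
have e2_gt0 : 0 < h * t by rewrite -De lt_def sqrf_eq0 e0 -realEsqr; apply/CrealP.
have {h0 e2_gt0 Kh Kt} : exists h t, [/\ [/\ Qsqrt p1 h, h \in Aint, h * sg h = 1 & 0 < h],
    [/\ Qsqrt (2 * p2) t, t \in Aint, t * sg t = 1 & 0 < t] & e ^+ 2 = h * t].
  (* The product h t = e^2 is positive, so both signs can be changed together. *)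
  have [pos|neg] := real_unit_sign (Qsqrt_subfield _) (@Qsqrt_real _) Qh h0.
    by exists h, t; split=> //; split=> //; rewrite -(pmulr_rgt0 _ pos).
  exists (- h), (- t); rewrite mulrNN !sg_mul_opp !rpredN; split=> //; split=> //.
  - exact: (subfieldN (Qsqrt_subfield _)).
  - exact: (subfieldN (Qsqrt_subfield _)).
  by rewrite -(pmulr_rgt0 _ neg) mulrNN.
move: h t {De Qh Qt Zh Zt Nh Nt} => _ _ [h [t [[Qh Zh Nh h_gt0] [Qt Zt Nt t_gt0] De]]].
have [w Uw Dw] := pos_unit_A Qh Zh Nh h_gt0.
have Kw := Qsqrt_sub_K K_A (proj1 (proj1 Uw)).
have Ut : unitO (Qsqrt (2 * p2)) t.
  apply: unitO_inv_Aint => //; [exact: Qsqrt_subfield | exact: lt0r_neq0 |].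
  by rewrite (mulr1_eq Nt) Aint_aut.
have [v Qv [Dv|Dv]] := pos_unit_B Qt Zt Nt t_gt0; last first.
  have Kv := Qsqrt_sub_K K_B Qv.
  (* With h = w^2 and 2 t = v^2, the element w v / e would be a square root of 2. *)
  have := sqrt2_notin_K (subfieldM KS (subfieldM KS Kw Kv) (subfieldV KS Ke)).
  rewrite expr_div_n exprMn De -Dw -Dv mulrCA mulfK ?eqxx //.
  by rewrite mulf_neq0 // lt0r_neq0.
have Uv : unitO (Qsqrt (2 * p2)) v by apply: (unitO_sqr (Qsqrt_subfield _)) => //; rewrite -Dv.
have Nv := norm_B_unit Uv.
have Cv : signed_coboundary v by apply: coboundary_B => //; case: Uv => -[].
have Zw : w \in Aint by case: Uw => -[].
have Qw : Qsqrt p1 w by case: Uw => -[].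
have : e ^+ 2 == (w * v) ^+ 2 by rewrite De Dw Dv exprMn.
(* A unit w of Q(A) could have norm -1; that e and v have norm 1 rules this out. *)
have Nw (b : algC) : b * sg b = 1 -> b = w * v \/ b = - (w * v) -> w * sg w = 1.
  move=> Nb Hb; have : (w * v) * sg (w * v) = 1 by case: Hb Nb => ->; rewrite ?sg_mul_opp.
  by rewrite rmorphM mulrACA Nv mulr1.
rewrite eqf_sqr => /orP[]/eqP Ee.
  have Cw : signed_coboundary w by apply: coboundary_A => //; apply: Nw N1 _; left.
  by rewrite Ee; apply: signed_coboundaryM.
have Cw : signed_coboundary w by apply: coboundary_A => //; apply: Nw N1 _; right.
by rewrite Ee; apply/signed_coboundaryN/signed_coboundaryM.
Qed.

(* w = e / e^* has absolute value 1 everywhere, and w^2 is the product of its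
   relative norms to Q(i, A) and Q(i, B), which lie in Q(iA) and Q(iB). *)
Lemma unit_norm1_conj e : U e -> e * sg e = 1 -> e^* = e \/ e^* = - e.
Proof.
move=> Ue N1; have [[Ke Ze] [e0 _]] := Ue; have KS := K_subfield.
have [w Ew] : exists w, w = e / e^* by exists (e / e^*).
have Uw : U w by rewrite Ew; apply: U_div => //; apply: U_conj.
have [[Kw Zw] [w0 _]] := Uw.
have ec0 : e^* != 0 by rewrite conjC_eq0.
have sec : sg e^* = (sg e)^* by rewrite sg_conj.
have Nw : w * sg w = 1.
  rewrite Ew fmorph_div sec mulrACA -invfM -conjCM N1.
  by rewrite (rmorph1 Num.conj) invr1 mulr1.
have cw : w * w^* = 1.
  have cV : (e^*^-1)^* = e^-1 by rewrite -{2}[e]conjCK; exact: (fmorphV Num.conj).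
  by rewrite Ew conjCM cV mulrACA [_^-1 * _]mulrC -mulrACA !divff ?mulr1.
have Ksw := K_ss Kw.
have Nsw : ss w * sg (ss w) = 1 by rewrite sg_ss // -rmorphM Nw rmorph1.
have csw : ss w * (ss w)^* = 1 by rewrite -ss_conj // -rmorphM cw rmorph1.
pose h := w * ss w; pose t := w * sg (ss w).
have Kh : K h by apply: (subfieldM KS).
have Kt : K t by apply: (subfieldM KS) => //; apply: K_sg.
have ch : h * h^* = 1 by rewrite /h conjCM mulrACA cw csw mulr1.
have ct : t * t^* = 1.
  by rewrite /t conjCM mulrACA cw mul1r -sg_conj // -rmorphM csw rmorph1.
have Nh : h * sg h = 1 by rewrite rmorphM mulrACA Nw Nsw mulr1.
have Nt : t * sg t = 1 by rewrite rmorphM /= sgK // mulrACA Nw mul1r mulrC.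
have h2 : h ^+ 2 = 1.
  have [a [b Dh]] : exists a b : rat, h = ratr a + ratr b * ('i * A).
    apply: fixed_ss_sgconj => //; first by rewrite rmorphM ssK // mulrC.
    rewrite -(mulr1_eq ch) fmorphV; apply: mulr1_eq; by rewrite mulrC.
  apply: unit_imaginary Dh _ ch; [exact: squarefree_prime | exact: p1_ge5 |].
  by rewrite rpredM // Aint_aut.
have t2 : t ^+ 2 = 1.
  have [a [b Dt]] : exists a b : rat, t = ratr a + ratr b * ('i * B).
    apply: fixed_sgss_sgconj => //.
      by rewrite !rmorphM /= -(sg_ss Ksw) ssK // sgK // mulrC.
    rewrite -(mulr1_eq ct) fmorphV; apply: mulr1_eq; by rewrite mulrC.
  apply: unit_imaginary Dt _ ct; [exact: squarefree_2p2 | by rewrite (leq_trans p2_ge5) // leq_pmull |].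
  by rewrite rpredM // !Aint_aut.
have Dw : w ^+ 2 = h * t by rewrite /h /t mulrACA Nsw mulr1.
have w4 : w ^+ 4 = 1 by rewrite (exprM w 2 2) Dw exprMn h2 t2 mulr1.
(* A fourth root of unity is fixed by [sg], so its relative norm 1 is its square. *)
have : w ^+ 2 == 1 by rewrite expr2 -{2}(mu4_sg w4) Nw.
have Ee : e = w * e^* by rewrite Ew divfK.
rewrite sqrf_eq1 => /orP[]/eqP w1; [left|right]; move: Ee; rewrite w1.
  by rewrite mul1r.
by rewrite mulN1r => /(congr1 -%R); rewrite opprK.
Qed.

Lemma norm1_coboundary g e : U g -> g * sg g = 1 -> g^* = - g -> U e -> e * sg e = 1 ->
  signed_coboundary e \/ signed_coboundary (e / g).
Proof.
move=> Ug Ng cg Ue Ne; have [ce|ce] := unit_norm1_conj Ue Ne.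
  by left; apply: real_coboundary.
right; apply: real_coboundary; first exact: U_div.
  by rewrite fmorph_div mulrACA -invfM Ne Ng invr1 mulr1.
by rewrite conjCM (fmorphV Num.conj) /= ce cg invrN mulrNN.
Qed.

End UpperBound.

(** * Units that are not coboundaries *)

Lemma rat_unit_pos (q : rat) : 0 < q -> q \in Num.int -> q^-1 \in Num.int -> q = 1.
Proof.
move=> q0 /intrP[x Dx] /intrP[y Dy].
have q1 : q * q^-1 = 1 by rewrite divff // lt0r_neq0.
have xy : x * y = 1 by apply: (@intr_inj rat); rewrite rmorphM /= -Dx -Dy q1.
have x0 : 0 < x by move: q0; rewrite Dx ltr0z.
have y0 : 0 < y by nia.
by have x1 : x = 1 by [nia]; rewrite Dx x1.
Qed.

Lemma unit_abs1 z (q : rat) : U z -> z * z^* = ratr q -> z * z^* = 1.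
Proof.
move=> Uz Dq; have [[Kz Zz] [z0 [KV ZV]]] := Uz.
have q0 : 0 < q by rewrite -(@ltr0q algC) -Dq mul_conjC_gt0.
rewrite Dq (rat_unit_pos q0) ?rmorph1 //; apply: Aint_ratr.
  by rewrite -Dq rpredM // Aint_aut.
by rewrite fmorphV /= -Dq invfM rpredM // -(fmorphV Num.conj) Aint_aut.
Qed.

(* With v = u / u^*, the equation u / sg u = g forces sg v = - v, while v^2 is
   the product of a unit of Q(i) and a unit of Q(iD), so that v^8 = 1. *)
Lemma imaginary_coboundary g u : U u -> g^* = - g -> u / sg u != g.
Proof.
move=> Uu cg; apply/eqP => E; have [[Ku Zu] [u0 _]] := Uu; have KS := K_subfield.
have su0 : sg u != 0 by rewrite fmorph_eq0.
have uc0 : u^* != 0 by rewrite conjC_eq0.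
have [v Dv] : exists v, v = u / u^* by exists (u / u^*).
have Uv : U v by rewrite Dv; apply: U_div => //; apply: U_conj.
have [[Kv Zv] [v0 _]] := Uv.
have sv : sg v = - v.
  have E1 : u = g * sg u by rewrite -E divfK.
  have E2 : u^* = - g * (sg u)^* by rewrite {1}E1 conjCM cg.
  have g0 : g != 0 by apply: contraNneq u0 => g0; rewrite E1 g0 mul0r.
  have suc0 : (sg u)^* != 0 by rewrite conjC_eq0.
  have E3 : u / u^* = - (sg u / (sg u)^*).
    by rewrite E2 {1}E1; field; rewrite suc0 g0.
  by rewrite Dv fmorph_div sg_conj // E3 opprK.
have cv : v * v^* = 1.
  have cV : (u^*^-1)^* = u^-1 by rewrite -{2}[u]conjCK; exact: (fmorphV Num.conj).
  by rewrite Dv conjCM cV mulrACA [_^-1 * _]mulrC -mulrACA !divff ?mulr1.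
have Kv' := K_ss Kv; have Kvc := K_conj Kv.
pose h := v * ss v; pose t := v * ss v^*.
have csv : ss v * ss v^* = 1 by rewrite -rmorphM cv rmorph1.
have ch : h * h^* = 1 by rewrite /h conjCM mulrACA cv mul1r -ss_conj.
have ct : t * t^* = 1 by rewrite /t conjCM mulrACA cv mul1r -ss_conj // conjCK mulrC.
have ssv : sg (ss v) = - ss v by rewrite sg_ss // sv rmorphN.
have ssvc : sg (ss v^*) = - ss v^* by rewrite sg_ss // sg_conj // sv conjCN rmorphN.
have h4 : h ^+ 4 = 1.
  have [a [b Dh]] : exists a b : rat, h = ratr a + ratr b * 'i.
    apply: fixed_sg_ss; first exact: (subfieldM KS).
      by rewrite rmorphM /= sv ssv mulrNN.
    by rewrite rmorphM ssK // mulrC.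
  by apply: unit_gaussian Dh _ ch; rewrite rpredM // Aint_aut.
have t2 : t ^+ 2 = 1.
  have [a [b Dt]] : exists a b : rat, t = ratr a + ratr b * ('i * D).
    apply: fixed_sg_ssconj; first by apply: (subfieldM KS) => //; apply: K_ss.
      by rewrite rmorphM /= sv ssvc mulrNN.
    by rewrite conjCM rmorphM /= -(ss_conj Kvc) conjCK ssK // mulrC.
  apply: unit_imaginary Dt _ ct; [exact: squarefree_d | | by rewrite rpredM // !Aint_aut].
  exact: d_ge5.
have v2 : v ^+ 2 = h * t by rewrite /h /t mulrACA csv mulr1.
move/eqP: (odd_not_mu8 Kv sv); apply.
by rewrite (exprM v 2 4) v2 exprMn h4 mul1r (exprM t 2 2) t2 expr1n.
Qed.

Section MinusOne.
Variables e3 t3 : algC.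
Hypotheses (fe3 : fund_unit (2 * p1 * p2) e3) (Qt3 : Qsqrt (2 * p1 * p2) t3) (Dt3 : 2 * e3 = t3 ^+ 2).

(* If sg u = - u, then u^2 is a root of unity times the unit u u^* of Q(D); the
   latter is t^2 or e3 t^2 and 2 e3 is a square, so u times an element of k is
   an eighth root of unity negated by sg. *)
Lemma minus_one_not_coboundary u : U u -> sg u != - u.
Proof.
move=> Uu; apply/eqP => su; have [[Ku Zu] [u0 _]] := Uu; have KS := K_subfield.
have Ku' := K_ss Ku; have Kuc := K_conj Ku.
have e30 : e3 != 0 by case: fe3 => [[_ []]].
have t30 : t3 != 0.
  have : t3 ^+ 2 != 0 by rewrite -Dt3 mulf_neq0 // pnatr_eq0.
  by rewrite expf_eq0.
pose h := u * ss u; pose t := u * ss u^*; pose x := u * u^*.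
have ssu : sg (ss u) = - ss u by rewrite sg_ss // su rmorphN.
have suc : sg u^* = - u^* by rewrite sg_conj // su conjCN.
have ssuc : sg (ss u^*) = - ss u^* by rewrite sg_ss // suc rmorphN.
have Uh : U h by apply: UM => //; apply: U_ss.
have Ut : U t by apply: UM => //; apply/U_ss/U_conj.
have Ux : U x by apply: UM => //; apply: U_conj.
have [[Kh Zh] _] := Uh; have [[Kt Zt] _] := Ut; have [[Kx Zx] [x0 [_ ZxV]]] := Ux.
have sh : sg h = h by rewrite rmorphM /= su ssu mulrNN.
have ssh : ss h = h by rewrite rmorphM ssK // mulrC.
have st : sg t = t by rewrite rmorphM /= su ssuc mulrNN.
have sstc : ss t^* = t by rewrite conjCM rmorphM /= -(ss_conj Kuc) conjCK ssK // mulrC.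
have sst : ss t = t^* by rewrite -{1}sstc ssK //; apply: K_conj.
have [a [b Dh]] := fixed_sg_ss Kh sh ssh.
have [c [d Dt]] := fixed_sg_ssconj Kt st sstc.
have ch : h * h^* = 1.
  have [q Dq] : exists q : rat, h * h^* = ratr q; last exact: unit_abs1 Dq.
  apply: fixed_all; first exact: (subfieldM KS Kh (K_conj Kh)).
  - by rewrite rmorphM sg_conj // sh.
  - by rewrite rmorphM ss_conj // ssh.
  by rewrite conjCM conjCK mulrC.
have ct : t * t^* = 1.
  have [q Dq] : exists q : rat, t * t^* = ratr q; last exact: unit_abs1 Dq.
  apply: fixed_all; first exact: (subfieldM KS Kt (K_conj Kt)).
  - by rewrite rmorphM sg_conj // st.
  - by rewrite rmorphM sst sstc mulrC.
  by rewrite conjCM conjCK mulrC.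
have h4 : h ^+ 4 = 1 by exact: unit_gaussian Dh Zh ch.
have t2 : t ^+ 2 = 1.
  apply: unit_imaginary Dt Zt ct; first exact: squarefree_d.
  exact: d_ge5.
have sx : sg x = x by rewrite rmorphM /= su suc mulrNN.
have cx : x^* = x by rewrite conjCM conjCK mulrC.
have Qx : unitO (Qsqrt (2 * p1 * p2)) x.
  have [a' [b' Dx]] := fixed_sg_conj Kx sx cx.
  apply: unitO_inv_Aint => //; first exact: Qsqrt_subfield.
  by exists (ratr a'), (ratr b'); split; [exists a' | split; [exists b'|]].
have x_gt0 : 0 < x by rewrite mul_conjC_gt0.
have xssx : x * ss x = 1.
  by rewrite -[RHS]ch /h /x conjCM -ss_conj // rmorphM mulrACA.
(* By definition h t = u^2 ss(x), and ss(x) is the inverse of x. *)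
have u2 : u ^+ 2 = h * t * x.
  have ssx0 : ss x != 0 by rewrite fmorph_eq0.
  apply: (mulIf ssx0); rewrite -[RHS]mulrA xssx mulr1 /h /t rmorphM /=; ring.
have [y Uy Dy] := fund_unit_sqclass fe3 Qx x_gt0.
have [[Qy _] [y0 _]] := Uy.
have sgQ z : Qsqrt (2 * p1 * p2) z -> sg z = z by move=> Qz; apply/k_fixed/Qsqrt_sub_k.
have KQ z : Qsqrt (2 * p1 * p2) z -> K z by move=> Qz; apply/k_sub_K/Qsqrt_sub_k.
have ht8 : (h * t) ^+ 4 = 1 by rewrite exprMn h4 (exprM t 2 2) t2 expr1n mul1r.
case: Dy => Dy.
  have suy : sg (u / y) = - (u / y) by rewrite fmorph_div su sgQ // mulNr.
  move/eqP: (odd_not_mu8 (subfieldM KS Ku (subfieldV KS (KQ _ Qy))) suy); apply.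
  by rewrite (exprM _ 2 4) expr_div_n u2 Dy mulfK ?expf_neq0.
(* Chosen so that v^2 = h t 'i: here x = e3 y^2, t3^2 = 2 e3 and (1 + 'i)^2 = 2 'i. *)
pose v := u * (1 + 'i) / (t3 * y).
have Kv : K v.
  apply: (subfieldM KS); last apply: (subfieldV KS); apply: (subfieldM KS) => //; auto.
  exact: (subfieldD KS (subfield1 KS) K_i).
have sv : sg v = - v.
  by rewrite fmorph_div !rmorphM /= su rmorphD rmorph1 sg_i !sgQ // !mulNr.
move/eqP: (odd_not_mu8 Kv sv); apply.
have -> : v ^+ 8 = (h * t * 'i) ^+ 4.
  rewrite (exprM v 2 4); congr (_ ^+ _).
  rewrite expr_div_n !exprMn u2 Dy sqr_1Di -Dt3; field.
  by rewrite y0 e30.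
by rewrite exprMn ht8 mul1r (exprM 'i 2 2) sqrCi sqrrN expr1n.
Qed.
End MinusOne.

(** * Capitulation *)

Definition contraction (g z : algC) : Prop := OK k z /\ exists y, OK K y /\ z = g * y.

Lemma OKM (F : fld) x y : subfield F -> OK F x -> OK F y -> OK F (x * y).
Proof. by move=> FF [Fx Zx] [Fy Zy]; split; [apply: subfieldM | apply: rpredM]. Qed.

Lemma OKD (F : fld) x y : subfield F -> OK F x -> OK F y -> OK F (x + y).
Proof. by move=> FF [Fx Zx] [Fy Zy]; split; [apply: subfieldD | apply: rpredD]. Qed.

Lemma OK_sub x : OK k x -> OK K x.
Proof. by move=> [kx Zx]; split=> //; apply: k_sub_K. Qed.

Lemma OK_sg x : OK K x -> OK K (sg x).
Proof. by move=> [Kx Zx]; split; [apply: K_sg | rewrite Aint_aut]. Qed.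

Lemma OK_fixed x : OK K x -> sg x = x -> OK k x.
Proof. by move=> [Kx Zx] sx; split=> //; apply: fixed_k. Qed.

Lemma OK_trace x : OK K x -> OK k (x + sg x).
Proof.
move=> /[dup] Ox [Kx _]; apply: OK_fixed; first by apply: OKD K_subfield _ _ => //; apply: OK_sg.
by rewrite rmorphD /= sgK // addrC.
Qed.

Lemma OK_norm x : OK K x -> OK k (x * sg x).
Proof.
move=> /[dup] Ox [Kx _]; apply: OK_fixed; first by apply: OKM K_subfield _ _ => //; apply: OK_sg.
by rewrite rmorphM /= sgK // mulrC.
Qed.

Lemma ext_idealM (I : algC -> Prop) y x : OK K y -> ext_ideal K I x -> ext_ideal K I (y * x).
Proof.
move=> Oy [s [Hs ->]]; exists [seq (q.1, y * q.2) | q <- s]; split.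
  move=> _ /mapP[q /Hs[Iq Oq] ->]; split=> //=; exact: OKM K_subfield _ _.
by rewrite big_map mulr_sumr; apply: eq_bigr => q _ /=; rewrite mulrCA.
Qed.

Section Capitulating.
Variables (I : algC -> Prop) (g : algC).
Hypotheses (idI : ideal k I) (OKg : OK K g).
Hypothesis extI : forall z, ext_ideal K I z <-> exists y, OK K y /\ z = g * y.

Lemma ideal_ext z : I z -> ext_ideal K I z.
Proof.
move=> Iz; exists [:: (z, 1)]; split; last by rewrite big_seq1 mulr1.
move=> q; rewrite inE => /eqP ->; split=> //=; split; last exact: Aint1.
exact: (subfield1 K_subfield).
Qed.

Lemma ext_gen : ext_ideal K I g.
Proof.
apply/extI; exists 1; rewrite mulr1; split=> //; split; last exact: Aint1.
exact: (subfield1 K_subfield).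
Qed.

Lemma generator_neq0 : g != 0.
Proof.
case: idI => [[z [Iz z0]] _ _ _ _]; apply: contraNneq z0 => g0.
by have /extI[y [_ ->]] := ideal_ext Iz; rewrite g0 mul0r.
Qed.

Lemma ext_sg x : ext_ideal K I x -> ext_ideal K I (sg x).
Proof.
case: idI => _ IO _ _ _ [s [Hs ->]]; exists [seq (q.1, sg q.2) | q <- s]; split.
  by move=> _ /mapP[q /Hs[Iq Oq] ->]; split=> //=; apply: OK_sg.
rewrite big_map rmorph_sum /= [LHS]big_seq [RHS]big_seq; apply: eq_bigr => q /Hs[Iq _].
by rewrite rmorphM /= (k_fixed (proj1 (IO _ Iq))).
Qed.

(** The extended ideal is stable under [sg], so g and sg g generate the same ideal. *)
Lemma generator_unit : U (g / sg g).
Proof.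
have g0 := generator_neq0.
have /extI[y [Oy Dy]] := ext_sg ext_gen.
have sg0 : sg g != 0 by rewrite fmorph_eq0.
have E : sg g * sg y = g by rewrite -rmorphM -Dy (sgK (proj1 OKg)).
have -> : g / sg g = sg y by rewrite -{1}E mulrC mulKf.
have Ny : sg y * y = 1.
  by apply: (mulfI sg0); rewrite mulrA E mulr1 Dy.
have [[Ky Zy] [Ksy Zsy]] := (Oy, OK_sg Oy).
split; [by [] | split]; last by rewrite (mulr1_eq Ny).
by apply: contra_eq_neq Ny => ->; rewrite mul0r eq_sym oner_neq0.
Qed.

(** A term q y with q in I has trace q (y + sg y), an O_k-multiple of q. *)
Lemma trace_ext x : ext_ideal K I x -> I (x + sg x).
Proof.
case: idI => _ IO I0 ID IM [s [Hs ->]].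
elim: s Hs => [|q s IHs] Hs; first by rewrite big_nil rmorph0 addr0.
rewrite big_cons rmorphD /= addrACA; apply: ID; last first.
  by apply: IHs => r rs; apply: Hs; rewrite inE rs orbT.
have [Iq Oq] := Hs q (mem_head _ _).
rewrite rmorphM /= (k_fixed (proj1 (IO _ Iq))) -mulrDr mulrC.
by apply: IM => //; apply: OK_trace.
Qed.

(* I^2 is generated by the norm of g, so I is invertible and the extension of
   I contracts back to I. *)
Lemma capitulating_contraction z : I z <-> contraction g z.
Proof.
have g0 := generator_neq0; case: (idI) => _ IO I0 ID IM; split=> [Iz|[Oz [y [Oy Dz]]]].
  by split; [exact: IO | apply/extI/ideal_ext].
have sg0 : sg g != 0 by rewrite fmorph_eq0.
(* With z = g y and a = g t, and a fixed by [sg], the product w a equals y sg t, which is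
   integral. *)
have w_int a : I a -> OK k (z / (g * sg g) * a).
  move=> Ia; have /extI[t [Ot Da]] := ideal_ext Ia.
  have sa : sg a = a by apply: k_fixed; case: (IO _ Ia).
  have E : z / (g * sg g) * a = y * sg t.
    by rewrite -{1}sa Da rmorphM /= Dz; field; rewrite g0 sg0.
  apply: OK_fixed; first by rewrite E; apply: OKM K_subfield _ _ => //; apply: OK_sg.
  have kz : sg z = z by apply: k_fixed; case: Oz.
  by rewrite rmorphM fmorph_div kz sa rmorphM /= (sgK (proj1 OKg)) [g * _]mulrC.
set w := z / _ in w_int.
have -> : z = w * (g * sg g) by rewrite /w divfK // mulf_neq0.
have [s [Hs ->]] := ext_gen.
elim: s Hs => [|q s IHs] Hs; first by rewrite big_nil mul0r mulr0.
have {}IHs := IHs (fun r rs => Hs r (mem_behead (s := q :: s) rs)).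
have Es : ext_ideal K I (\sum_(r <- s) r.1 * r.2).
  by exists s; split=> // r rs; apply: Hs; rewrite inE rs orbT.
have [Iq Oq] := Hs q (mem_head _ _); have Owq := w_int _ Iq.
rewrite big_cons; move: (\sum_(r <- s) _) IHs Es => x IHs Es.
have sq : sg q.1 = q.1 by apply: k_fixed; case: (IO _ Iq).
have Kx : K x by have /extI[t [[Kt _] ->]] := Es; apply: (subfieldM K_subfield) => //; case: OKg.
(* The norm of a sum of terms is expanded. As w q.1 is integral, the first two summands are integral
   multiples of a norm times q.1 and of a trace, both in I; the last is covered by induction. *)
have -> : w * ((q.1 * q.2 + x) * sg (q.1 * q.2 + x)) =
    w * q.1 * ((q.2 * sg q.2) * q.1) + w * q.1 * (sg q.2 * x + sg (sg q.2 * x)) + w * (x * sg x).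
  by rewrite rmorphD !rmorphM /= sq (sgK (proj1 Oq)); ring.
apply: (ID _ _ _ IHs); apply: (ID _ _ _ _); apply: (IM _ _ _ _) => //.
  by apply: (IM _ _ _ _) => //; exact: OK_norm.
by apply: trace_ext; apply: ext_idealM => //; apply: OK_sg.
Qed.

End Capitulating.

Lemma ideal_equiv_ext (I J : algC -> Prop) a b x :
  (forall z, (exists w, I w /\ z = a * w) -> (exists w, J w /\ z = b * w)) ->
  ext_ideal K I x -> exists2 y, ext_ideal K J y & a * x = b * y.
Proof.
move=> H [s [Hs ->]]; elim: s Hs => [|q s IHs] Hs.
  by exists 0; [exists [::]; rewrite big_nil; split | rewrite big_nil !mulr0].
have [|y [s' [Hs' Dy]] E] := IHs; first by move=> r rs; apply: Hs; rewrite inE rs orbT.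
have [Iq Oq] := Hs q (mem_head _ _).
have [w [Jw Dw]] := H (a * q.1) (ex_intro _ q.1 (conj Iq erefl)).
exists (w * q.2 + y); last by rewrite big_cons !mulrDr E mulrA Dw mulrA.
exists ((w, q.2) :: s'); split; last by rewrite big_cons Dy.
by move=> r; rewrite inE => /orP[/eqP ->|/Hs'].
Qed.

(** The value at [sg] of the cocycle attached to a generator; modulo cocycles of units it determines
    the ideal class. *)
Definition cocycle g := g / sg g.

Section Equivalence.
Variables (I J : algC -> Prop) (g h : algC).
Hypotheses (idI : ideal k I) (OKg : OK K g)
  (extI : forall z, ext_ideal K I z <-> exists y, OK K y /\ z = g * y).
Hypotheses (idJ : ideal k J) (OKh : OK K h)
  (extJ : forall z, ext_ideal K J z <-> exists y, OK K y /\ z = h * y).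

(** From a I = b J follows a g = b h y with y a unit of K; the scalars lie in k and drop out of the
    cocycles. *)
Lemma ideal_equiv_cocycle : ideal_equiv k I J ->
  exists2 u, U u & cocycle g = cocycle h * cocycle u.
Proof.
move=> [a [b [[ka Za] [kb Zb] a0 b0 H]]].
have g0 := generator_neq0 idI extI; have h0 := generator_neq0 idJ extJ.
have [_ /extJ[y [Oy ->]] Eg] := ideal_equiv_ext (fun z => proj1 (H z)) (ext_gen extI).
have [_ /extI[x [Ox ->]] Eh] := ideal_equiv_ext (fun z => proj2 (H z)) (ext_gen extJ).
have yx : y * x = 1.
  apply: (mulfI h0); apply: (mulfI b0); rewrite mulr1 Eh !mulrA -mulrA.
  by rewrite !mulrA Eg !mulrA.
have y0 : y != 0 by apply: contra_eq_neq yx => ->; rewrite mul0r eq_sym oner_neq0.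
exists y; first by split=> //; split=> //; rewrite (mulr1_eq yx).
have Dg : g = b / a * (h * y) by apply: (mulfI a0); rewrite Eg; field.
have sab : sg (b / a) = b / a by rewrite fmorph_div !k_fixed.
have ba0 : b / a != 0 by rewrite mulf_neq0 ?invr_eq0.
rewrite /cocycle Dg rmorphM sab rmorphM /=; move: (b / a) ba0 => c c0; field.
by rewrite c0 !fmorph_eq0 h0 y0.
Qed.

(** The ratio r = g / (h u) is fixed by [sg], so it lies in k and carries J to I. Multiplication by
    the norm of h makes the two scalars integral. *)
Lemma cocycle_ideal_equiv u : U u -> cocycle g = cocycle h * cocycle u -> ideal_equiv k I J.
Proof.
move=> Uu E; have [[Ku Zu] [u0 [KuV ZuV]]] := Uu.
have g0 := generator_neq0 idI extI; have h0 := generator_neq0 idJ extJ.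
have sg0 : sg g != 0 by rewrite fmorph_eq0.
have sh0 : sg h != 0 by rewrite fmorph_eq0.
have su0 : sg u != 0 by rewrite fmorph_eq0.
have KS := K_subfield; have [Kg Zg] := OKg; have [Kh Zh] := OKh.
have [r Dr] : exists r, r = g / (h * u) by eexists.
have r0 : r != 0 by rewrite Dr mulf_neq0 // invr_eq0 mulf_neq0.
have Kr : K r by rewrite Dr; apply: (subfieldM KS) => //; apply: (subfieldV KS); apply: (subfieldM KS).
have sr : sg r = r.
  have Dg : g = h / sg h * (u / sg u) * sg g by rewrite -E /cocycle divfK.
  by rewrite Dr fmorph_div rmorphM {2}Dg; field; rewrite h0 u0 su0 sh0.
have kr := fixed_k Kr sr.
have Oa : OK k (h * sg h) by apply: OK_norm.
have Db : h * sg h * r = g * sg h * u^-1 by rewrite Dr; field; rewrite h0 u0.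
have Ob : OK k (h * sg h * r).
  split; first by apply: (subfieldM k_subfield) => //; case: Oa.
  by rewrite Db !rpredM // Aint_aut.
have a0 : h * sg h != 0 by rewrite mulf_neq0.
exists (h * sg h), (h * sg h * r); split=> //; first by rewrite mulf_neq0.
have Dgr : g = h * u * r by rewrite Dr mulrC divfK // mulf_neq0.
move=> z; split=> [[w [Iw ->]]|[w [Jw ->]]].
  have [[kw Zw] [y [Oy Dw]]] := proj1 (capitulating_contraction idI OKg extI w) Iw.
  exists (w / r); split; last by field.
  have Dwr : w / r = h * (u * y) by rewrite Dw Dgr; field.
  have Ouy : OK K (u * y) by apply: (OKM KS).
  apply/(capitulating_contraction idJ OKh extJ); split; last by exists (u * y).
  split; first by apply: (subfieldM k_subfield) => //; apply: (subfieldV k_subfield).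
  by rewrite Dwr rpredM //; case: Ouy.
have [[kw Zw] [y [Oy Dw]]] := proj1 (capitulating_contraction idJ OKh extJ w) Jw.
exists (r * w); split; last by rewrite mulrA.
have Dwr : r * w = g * (u^-1 * y) by rewrite Dw Dgr; field.
have Ouy : OK K (u^-1 * y) by apply: (OKM KS).
apply/(capitulating_contraction idI OKg extI); split; last by exists (u^-1 * y).
split; first exact: (subfieldM k_subfield).
by rewrite Dwr rpredM //; case: Ouy.
Qed.
End Equivalence.

(** * From units back to ideals *)

(** A root of X^2 - X - (p1 - 1)/4; this is what keeps K/k unramified above 2. *)
Lemma Aint_half1A : (1 + A) / 2 \in Aint.
Proof.
have [c Dc] : exists c, p1 = (4 * c + 1)%N by exists (p1 %/ 4)%N; lia.
apply: (@root_monic_Aint ('X^2 - 'X - c%:R%:P)).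
- rewrite /root !hornerE; apply/eqP.
  transitivity ((A ^+ 2 - 1) / 4 - c%:R); first by field.
  by rewrite sqrA Dc natrD natrM; field.
- rewrite monicE -addrA lead_coefDl ?lead_coefXn //.
  rewrite size_polyXn -opprD size_polyN (leq_ltn_trans (size_polyD _ _)) //.
  by rewrite size_polyX gtn_max /= (leq_ltn_trans (size_polyC_leq1 _)).
apply/polyOverP => i; rewrite !coefB coefXn coefX coefC.
by case: (i == 2%N); case: (i == 1%N); case: (i == 0%N);
  rewrite ?rpredB ?rpred_nat ?rpred0 ?rpred1.
Qed.

(* K/k is unramified: for a unit e with e sg e = 1 the elements t + e sg t,
   for t = 1, (1 + A)/2, B, generate the unit ideal. *)
Lemma contraction_generator a : OK K a -> a != 0 -> U (cocycle a) ->
  ideal k (contraction a) /\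
  forall z, ext_ideal K (contraction a) z <-> exists y, OK K y /\ z = a * y.
Proof.
move=> Oa a0 Ue; have [Ka Za] := Oa; have KS := K_subfield.
have sa0 : sg a != 0 by rewrite fmorph_eq0.
split.
  split.
  - exists (a * sg a); split; last by rewrite mulf_neq0.
    by split; [exact: OK_norm | exists (sg a); split=> //; exact: OK_sg].
  - by move=> z [].
  - split; first by split; [exact: (subfield0 k_subfield) | exact: Aint0].
    by exists 0; rewrite mulr0; split=> //; split; [exact: (subfield0 KS) | exact: Aint0].
  - move=> x y [Ox [x' [Ox' Dx]]] [Oy [y' [Oy' Dy]]]; split; first exact: (OKD k_subfield Ox Oy).
    by exists (x' + y'); rewrite Dx Dy mulrDr; split=> //; exact: (OKD KS Ox' Oy').
  move=> r x Or [Ox [x' [Ox' Dx]]]; split; first exact: (OKM k_subfield Or Ox).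
  exists (r * x'); rewrite Dx mulrCA; split=> //; exact: (OKM KS (OK_sub Or) Ox').
move=> z; split=> [[s [Hs ->]]|[y [Oy ->]]].
  elim: s Hs => [|q s IHs] Hs.
    by exists 0; rewrite big_nil mulr0; split=> //; split; [exact: (subfield0 KS) | exact: Aint0].
  have [|y [Oy Dy]] := IHs; first by move=> r rs; apply: Hs; rewrite inE rs orbT.
  have [[_ [x [Ox Dx]]] Oq] := Hs q (mem_head _ _).
  exists (x * q.2 + y); rewrite big_cons Dy Dx mulrDr mulrA; split=> //.
  by apply: (OKD KS) => //; apply: (OKM KS).
have [e De] : exists e, e = (cocycle a)^-1 by eexists.
have Uev := unitOV Ue; rewrite -De in Uev; have [[Ke Ze] [e0 [KeV ZeV]]] := Uev.
have sae : sg a = e * a by rewrite De /cocycle invf_div divfK.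
(* Because sg a = e a, this element is the trace of a t. *)
have tr t : OK K t -> contraction a (a * (t + e * sg t)).
  move=> Ot; have E : a * (t + e * sg t) = a * t + sg (a * t).
    by rewrite rmorphM /= sae; ring.
  split; first by rewrite E; apply: OK_trace; exact: (OKM KS).
  exists (t + e * sg t); split=> //; apply: (OKD KS) => //; apply: (OKM KS) => //; exact: OK_sg.
have O1 : OK K 1 by split; [exact: (subfield1 KS) | exact: Aint1].
have OA : OK K A by split; [exact: K_A | apply: Aint_sqr; rewrite sqrA rpred_nat].
have OB : OK K B by split; [exact: K_B | apply: Aint_sqr; rewrite sqrB rpred_nat].
have Ow : OK K ((1 + A) / 2).
  split; last exact: Aint_half1A.
  apply: (subfieldM KS); first exact: (subfieldD KS (subfield1 KS) K_A).
  exact/(subfieldV KS)/(subfield_nat KS).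
have OeV : OK K e^-1 by [].
have Oint (n : int) : OK K n%:~R by split; [exact: (subfield_int KS) | exact: Aint_int].
have [m [n Emn]] : exists m n : int, m * p1%:Z + n * (4 * p2)%N%:Z = 1.
  have [m [n Emn]] := Bezoutz p1%:Z (4 * p2)%N%:Z; exists m, n; rewrite Emn.
  rewrite /gcdz !absz_nat; apply: (congr1 Posz (_ : gcdn _ _ = 1%N)); apply/eqP.
  rewrite -/(coprime p1 (4 * p2)).
  rewrite coprimeMr (coprimeXr 2 (_ : coprime p1 2)) /=; last by rewrite coprimen2; move: p1_4; clear; lia.
  by rewrite prime_coprime // dvdn_prime2.
have Emn' : m%:~R * p1%:R + n%:~R * (4 * p2)%:R = 1 :> algC.
  by have := congr1 (fun z : int => z%:~R : algC) Emn; rewrite /= intrD !intrM -!pmulrn.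
pose w := (1 + A) / 2.
have sw : sg w = (1 - A) / 2 by rewrite fmorph_div rmorphD rmorph1 sgA rmorph_nat.
(* Write T(t) = t + e sg t. Then A e^-1 (w T(1) - T(w)) = A^2 = p1 and B (B T(1) + T(B)) = 2 B^2 = 4
   p2, which the Bezout coefficients m, n combine to 1. *)
exists [:: (a * (1 + e * sg 1), (m%:~R * A * e^-1 * w + n%:~R * B * B) * y);
           (a * (w + e * sg w), - (m%:~R * A * e^-1) * y);
           (a * (B + e * sg B), n%:~R * B * y)]; split.
  have O2 : OK K (m%:~R * A * e^-1) by do 2!apply: (OKM KS) => //.
  have O3 : OK K (n%:~R * B) by apply: (OKM KS).
  move=> q; rewrite !inE => /or3P[]/eqP -> /=; split; try exact: tr.
  - by apply: (OKM KS) => //; apply: (OKD KS); apply: (OKM KS).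
  - by apply: (OKM KS) => //; rewrite -mulN1r; apply: (OKM KS) => //; exact: (Oint (-1)).
  exact: (OKM KS).
rewrite !big_cons big_nil /= rmorph1 sw sgB addr0.
transitivity (a * y * (m%:~R * A ^+ 2 + n%:~R * (2 * B ^+ 2))).
  by rewrite sqrA sqrB -natrM mulnA Emn' mulr1.
by rewrite /w; field; rewrite e0.
Qed.

(** Counting classes becomes counting units of relative norm 1 modulo coboundaries: the class of [a]
    is that of its contraction. *)
Lemma capitulation_card_reps (s : seq algC) :
  (forall a, a \in s -> [/\ OK K a, a != 0 & U (cocycle a)]) ->
  (forall i j, (i < size s)%N -> (j < size s)%N -> i <> j ->
     forall u, U u -> cocycle s`_i <> cocycle s`_j * cocycle u) ->
  (forall e, U e -> e * sg e = 1 ->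
     exists2 a, a \in s & exists2 u, U u & e = cocycle a * cocycle u) ->
  capitulation_card k K (size s).
Proof.
move=> Hs Hneq Hall; exists (map contraction s).
have nthE i : (i < size s)%N -> nth (fun _ => False) (map contraction s) i = contraction s`_i.
  exact: nth_map.
have Hgen i : (i < size s)%N -> [/\ OK K s`_i, ideal k (contraction s`_i) &
    forall z, ext_ideal K (contraction s`_i) z <-> exists y, OK K y /\ z = s`_i * y].
  by move=> /(mem_nth 0)/Hs[Oa a0 Ua]; have [] := contraction_generator Oa a0 Ua.
split; first by rewrite size_map.
- by move=> i /[dup] Hi /Hgen[Oa ida exta]; rewrite nthE //; split=> //; exists s`_i.
- move=> i j Hi Hj ij; rewrite !nthE //.
  have [Oa ida exta] := Hgen i Hi; have [Ob idb extb] := Hgen j Hj.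
  move=> /(ideal_equiv_cocycle ida exta idb extb)[u Uu].
  exact: Hneq.
move=> I [idI [g [Og extI]]].
have Ue := generator_unit idI Og extI; have g0 := generator_neq0 idI extI.
have sg0 : sg g != 0 by rewrite fmorph_eq0.
have Ne : g / sg g * sg (g / sg g) = 1.
  by rewrite fmorph_div (sgK (proj1 Og)) mulrA divfK // divff.
have [a /[dup] sa /(nthP 0)[i Hi Di] [u Uu E]] := Hall _ Ue Ne.
exists i => //; rewrite nthE //; have [Oa ida exta] := Hgen i Hi.
by apply: (cocycle_ideal_equiv idI Og extI ida Oa exta Uu); rewrite Di.
Qed.

Lemma cocycle1 : cocycle 1 = 1.
Proof. by rewrite /cocycle rmorph1 divr1. Qed.

Lemma cocycle_A : cocycle A = -1.
Proof. by rewrite /cocycle sgA invrN mulrN divff // A_neq0. Qed.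

Lemma cocycleM x y : cocycle (x * y) = cocycle x * cocycle y.
Proof. by rewrite /cocycle rmorphM invfM mulrACA. Qed.

Lemma cocycle_eqN1 u : sg u = - u -> u != 0 -> cocycle u = -1.
Proof. by move=> su u0; rewrite /cocycle su invrN mulrN divff. Qed.

Section Count.
Variables e2 g : algC.
Hypotheses (fe2 : fund_unit (2 * p2) e2) (Ne2 : e2 * sg e2 = 1).
Hypotheses (Ug : U g) (Ng : g * sg g = 1) (cg : g^* = - g).

Lemma imaginary_neq0 : g != 0. Proof. by case: Ug => _ []. Qed.

Lemma imaginary_1D : 1 + g != 0.
Proof.
apply/eqP => /(canRL (addKr 1)); rewrite addr0 => E; have := cg; rewrite E opprK.
rewrite conjCN (rmorph1 Num.conj) => /eqP.
by rewrite eq_sym -addr_eq0 -[_ + _]/(2%:R) pnatr_eq0.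
Qed.

(** Hilbert 90 made explicit: sg g = g^-1 gives 1 + g = g sg(1 + g). *)
Lemma cocycle_imaginary : cocycle (1 + g) = g.
Proof.
have g0 := imaginary_neq0; rewrite /cocycle rmorphD rmorph1 -(mulr1_eq Ng).
have -> : 1 + g^-1 = (1 + g) / g by rewrite mulrDl mul1r divff // addrC.
by rewrite invf_div mulrC divfK // imaginary_1D.
Qed.

Lemma OK_1 : OK K 1.
Proof. by split; [exact: (subfield1 K_subfield) | exact: Aint1]. Qed.

Lemma OK_A : OK K A.
Proof. by split; [exact: K_A | apply: Aint_sqr; rewrite sqrA rpred_nat]. Qed.

Lemma OK_imaginary : OK K (1 + g).
Proof. by apply: (OKD K_subfield OK_1); case: Ug. Qed.

Lemma rep1 : [/\ OK K 1, 1 != 0 :> algC & U (cocycle 1)].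
Proof. by rewrite cocycle1 oner_neq0; split=> //; [exact: OK_1 | exact: (unitO1 K_subfield)]. Qed.

Lemma repg : [/\ OK K (1 + g), 1 + g != 0 & U (cocycle (1 + g))].
Proof. by rewrite cocycle_imaginary; split; [exact: OK_imaginary | exact: imaginary_1D | exact: Ug]. Qed.

Lemma repA x : [/\ OK K x, x != 0 & U (cocycle x)] -> [/\ OK K (A * x), A * x != 0 & U (cocycle (A * x))].
Proof.
move=> [Ox x0 Ux]; split; first exact: (OKM K_subfield OK_A Ox).
  by rewrite mulf_neq0 ?A_neq0.
by rewrite cocycleM cocycle_A mulN1r; apply: (unitON K_subfield).
Qed.

Lemma conj_inv_imaginary : (g^-1)^* = - g^-1.
Proof. by rewrite (fmorphV Num.conj) /= cg invrN. Qed.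

Lemma cocycle_not_imaginary u x : U u -> x^* = - x -> cocycle u <> x.
Proof. by move=> Uu cx; apply/eqP; apply: imaginary_coboundary. Qed.

(** The unit u0 makes -1 a coboundary, so every sign can be absorbed into a unit. *)
Lemma capitulation_card2 u0 : U u0 -> sg u0 = - u0 -> capitulation_card k K 2.
Proof.
move=> Uu0 su0; have g0 := imaginary_neq0.
have cu0 : cocycle u0 = -1 by apply: cocycle_eqN1 => //; case: Uu0 => _ [].
apply: (@capitulation_card_reps [:: 1; 1 + g]).
- by move=> a; rewrite !inE => /orP[]/eqP ->; [exact: rep1 | exact: repg].
- move=> [|[|//]] [|[|//]] //= _ _ _ u Uu; rewrite cocycle1 cocycle_imaginary => E.
    by apply: (cocycle_not_imaginary Uu conj_inv_imaginary); rewrite -[RHS]mulr1 [in RHS]E mulKf.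
  by apply: (cocycle_not_imaginary Uu cg); rewrite [RHS]E mul1r.
have sgn u e : U u -> e = cocycle u \/ e = - cocycle u -> exists2 v, U v & e = cocycle v.
  move=> Uu [] ->; first by exists u.
  by exists (u0 * u); [exact: UM | rewrite cocycleM cu0 mulN1r].
move=> e Ue Ne; have [[u Uu He]|[u Uu He]] := norm1_coboundary fe2 Ne2 Ug Ng cg Ue Ne.
  have [v Uv ->] := sgn u e Uu He; exists 1; first by rewrite inE eqxx.
  by exists v => //; rewrite cocycle1 mul1r.
have [v Uv Dv] := sgn u _ Uu He; exists (1 + g); first by rewrite !inE eqxx orbT.
by exists v => //; rewrite cocycle_imaginary -Dv mulrC divfK.
Qed.

Lemma capitulation_card4 : (forall u, U u -> sg u != - u) -> capitulation_card k K 4.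
Proof.
move=> Nm1; have g0 := imaginary_neq0; have cgV := conj_inv_imaginary.
have cgN : (- g)^* = - - g by rewrite conjCN cg.
have cgVN : (- g^-1)^* = - - g^-1 by rewrite conjCN cgV.
have cN1 u : U u -> cocycle u <> -1.
  move=> Uu E; have /eqP := Nm1 u Uu; apply.
  have u0 : u != 0 by case: Uu => _ [].
  have su0 : sg u != 0 by rewrite fmorph_eq0.
  by rewrite -[u in RHS](divfK su0) -/(cocycle u) E mulN1r opprK.
have Dcoc : [/\ cocycle 1 = 1, cocycle (1 + g) = g, cocycle (A * 1) = -1 & cocycle (A * (1 + g)) = - g].
  by rewrite !cocycleM cocycle1 cocycle_imaginary cocycle_A mulr1 mulN1r.
have [c1 c2 c3 c4] := Dcoc.
apply: (@capitulation_card_reps [:: 1; 1 + g; A * 1; A * (1 + g)]).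
- move=> a; rewrite !inE => /or4P[]/eqP ->; [exact: rep1 | exact: repg | |]; apply: repA.
    exact: rep1.
  exact: repg.
(* A ratio of two distinct cocycles among 1, g, -1, -g is -1, or g or g^-1 up to sign; none of these
   is the cocycle of a unit. *)
- have solve u x y z : U u -> x = y * cocycle u -> y != 0 -> z = x / y -> cocycle u = z.
    by move=> _ -> y0 ->; rewrite mulrC mulKf.
  have mN1 : (-1 : algC) != 0 by rewrite oppr_eq0 oner_neq0.
  have gN0 : - g != 0 by rewrite oppr_eq0.
  move=> [|[|[|[|//]]]] [|[|[|[|//]]]] //= _ _ _ u Uu; rewrite ?c1 ?c2 ?c3 ?c4 => E.
  + by apply: (cocycle_not_imaginary Uu cgV); apply: (solve _ _ _ _ Uu E) => //; field.
  + by apply: (cN1 _ Uu); apply: (solve _ _ _ _ Uu E) => //; field.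
  + by apply: (cocycle_not_imaginary Uu cgVN); apply: (solve _ _ _ _ Uu E) => //; field.
  + by apply: (cocycle_not_imaginary Uu cg); apply: (solve _ _ _ _ Uu E); rewrite ?oner_neq0 ?divr1 ?mul1r //.
  + by apply: (cocycle_not_imaginary Uu cgN); apply: (solve _ _ _ _ Uu E) => //; field.
  + by apply: (cN1 _ Uu); apply: (solve _ _ _ _ Uu E) => //; field.
  + by apply: (cN1 _ Uu); apply: (solve _ _ _ _ Uu E); rewrite ?oner_neq0 ?divr1 ?mul1r //.
  + by apply: (cocycle_not_imaginary Uu cgVN); apply: (solve _ _ _ _ Uu E) => //; field.
  + by apply: (cocycle_not_imaginary Uu cgV); apply: (solve _ _ _ _ Uu E) => //; field.
  + by apply: (cocycle_not_imaginary Uu cgN); apply: (solve _ _ _ _ Uu E); rewrite ?oner_neq0 ?divr1 ?mul1r //.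
  + by apply: (cN1 _ Uu); apply: (solve _ _ _ _ Uu E) => //; field.
  by apply: (cocycle_not_imaginary Uu cg); apply: (solve _ _ _ _ Uu E) => //; field.
move=> e Ue Ne; have [[u Uu [->|->]]|[u Uu He]] := norm1_coboundary fe2 Ne2 Ug Ng cg Ue Ne.
- by exists 1; rewrite ?inE ?eqxx //; exists u => //; rewrite c1 mul1r.
- by exists (A * 1); rewrite ?inE ?eqxx ?orbT //; exists u => //; rewrite c3 mulN1r.
have De : e = g * (e / g) by rewrite mulrC divfK.
case: He => He; [exists (1 + g) | exists (A * (1 + g))]; rewrite ?inE ?eqxx ?orbT //;
  exists u => //; rewrite De He ?c2 ?c4 // ?mulNr ?mulrN //.
Qed.
End Count.

(* i times a unit of norm -1 of Q(sqrt p1) *)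
Lemma imaginary_unit_exists : exists g, [/\ U g, g * sg g = 1 & g^* = - g].
Proof.
have [b [a Eab]] := negative_pell pr1 p1_4.
pose e := b%:R + a%:R * A.
have KS := K_subfield.
have Ke : K e.
  by apply: (subfieldD KS); [|apply: (subfieldM KS) K_A]; apply: (subfield_nat KS).
have se : sg e = b%:R - a%:R * A by rewrite rmorphD rmorphM !rmorph_nat /= sgA mulrN.
have ZA : A \in Aint by apply: Aint_sqr; rewrite sqrA rpred_nat.
have Eab' : b%:R ^+ 2 = p1%:R * a%:R ^+ 2 - 1 :> algC.
  by rewrite -!natrX -natrM -Eab natrD addrK.
have Ne : e * sg e = -1.
  rewrite se; transitivity (b%:R ^+ 2 - a%:R ^+ 2 * A ^+ 2 : algC); first by rewrite /e; ring.
  by rewrite sqrA Eab'; ring.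
have Ze : e \in Aint by rewrite rpredD ?rpredM ?rpred_nat.
have Ne' : e * - sg e = 1 by rewrite mulrN Ne opprK.
have e0 : e != 0 by apply: contra_eq_neq Ne' => ->; rewrite mul0r eq_sym oner_neq0.
have Ue : U e.
  by apply: (unitO_inv_Aint KS) => //; rewrite (mulr1_eq Ne') rpredN Aint_aut.
exists ('i * e); split; first exact: UM U_i Ue.
  by rewrite rmorphM /= sg_i mulrACA Ne -expr2 sqrCi mulrNN mulr1.
by rewrite conjCM conj_i conjC_lin !(rmorph_nat Num.conj) conj_sqrt mulNr.
Qed.

Lemma sg_norm_B (z : algC) : quad_norm (2 * p2) z 1 -> z * sg z = 1.
Proof.
move=> [a [b [-> /esym E]]]; rewrite aut_lin sgB !fmorph_rat.
transitivity (ratr a ^+ 2 - ratr b ^+ 2 * B ^+ 2); first by ring.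
transitivity (ratr 1 : algC); last exact: rmorph1.
by rewrite sqrB -E !(rmorphB, rmorphXn, rmorphM) /= ratr_nat; ring.
Qed.

Lemma ss_norm_D (z : algC) : quad_norm (2 * p1 * p2) z 1 -> z * ss z = 1.
Proof.
move=> [a [b [-> /esym E]]]; rewrite aut_lin ssD !fmorph_rat.
transitivity (ratr a ^+ 2 - ratr b ^+ 2 * D ^+ 2); first by ring.
transitivity (ratr 1 : algC); last exact: rmorph1.
by rewrite sqrD -E !(rmorphB, rmorphXn, rmorphM) /= ratr_nat; ring.
Qed.

(** * The square class of the fundamental unit of Q(D) *)

Section SquareClass.
Variables x y : int.
Local Notation e3 := (x%:~R + y%:~R * D).
Hypotheses (fe3 : fund_unit (2 * p1 * p2) e3) (Ne3 : e3 * ss e3 = 1).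

Lemma ss_e3 : ss e3 = x%:~R - y%:~R * D.
Proof. by rewrite aut_lin !rmorph_int ssD mulrN. Qed.

Lemma Qsqrt_e3 : Qsqrt (2 * p1 * p2) e3.
Proof. by case: fe3 => [[[]]]. Qed.

Lemma e3_neq0 : e3 != 0.
Proof. by case: fe3 => [[_ []]]. Qed.

(* 2 (x + 1) e3 = (e3 + 1)^2 and 2 (x - 1) e3 = (e3 - 1)^2 *)
Lemma double_e3_sqr n : x + 1 = (n ^ 2)%N%:Z \/ x - 1 = (n ^ 2)%N%:Z ->
  exists2 t, Qsqrt (2 * p1 * p2) t & 2 * e3 = t ^+ 2.
Proof.
have S := Qsqrt_subfield (2 * p1 * p2); have e31 : 1 < e3 by case: fe3.
have e30 := e3_neq0; have Qe := Qsqrt_e3.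
have trace (s : int) : s ^+ 2 = 1 -> (e3 + s%:~R) ^+ 2 = 2 * e3 * (x + s)%:~R.
  move=> s2; have s2' : s%:~R ^+ 2 = 1 :> algC by rewrite -rmorphXn /= s2.
  transitivity (e3 ^+ 2 + 2 * e3 * s%:~R + e3 * ss e3); last by rewrite ss_e3 intrD; ring.
  rewrite Ne3; transitivity (e3 ^+ 2 + 2 * e3 * s%:~R + s%:~R ^+ 2); first by ring.
  by rewrite s2'.
have main (s : int) : s ^+ 2 = 1 -> - s%:~R <= 1 :> algC -> x + s = (n ^ 2)%N%:Z ->
    exists2 t, Qsqrt (2 * p1 * p2) t & 2 * e3 = t ^+ 2.
  move=> s2 s1 E; have := trace s s2; rewrite E -pmulrn natrX => Et.
  (* If n were 0 then e3 = -s would be at most 1. *)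
  have n0 : n%:R != 0 :> algC.
    apply: contraTneq e31 => n0; move/eqP: Et; rewrite n0 expr0n mulr0 sqrf_eq0 addr_eq0 => /eqP ->.
    by rewrite -real_leNgt ?real1 // rpredN realz.
  exists ((e3 + s%:~R) / n%:R).
    apply: (subfieldM S); first exact: (subfieldD S Qe (subfield_int S _)).
    exact/(subfieldV S)/(subfield_nat S).
  by rewrite expr_div_n Et mulfK // expf_neq0.
case=> E; [apply: (main 1) | apply: (main (-1))] => //.
  by rewrite lerNl (le_trans (lerN10 _)) ?ler01.
by rewrite rmorphN1 opprK.
Qed.

(** A positive square root would be a unit strictly between 1 and e3. *)
Lemma e3_not_sqr t : Qsqrt (2 * p1 * p2) t -> e3 != t ^+ 2.
Proof.
move=> Qt; apply/eqP => E; have S := Qsqrt_subfield (2 * p1 * p2).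
have [Ue e31 e_min] := fe3.
have t0 : t != 0 by apply: contraTneq (e3_neq0) => t0; rewrite E t0 expr0n eqxx.
have Ut : unitO (Qsqrt (2 * p1 * p2)) t by apply: (unitO_sqr S) => //; rewrite -E.
wlog pos : t Qt E t0 Ut / 0 < t => [wlog|].
  have [pos|neg] := real_unit_sign S (@Qsqrt_real _) Qt t0; first exact: (wlog t).
  apply: (wlog (- t)); rewrite ?sqrrN ?oppr_eq0 //; first exact: (subfieldN S).
  exact: (unitON S).
have t1 : 1 < t by rewrite -(@ltr_pXn2r _ 2) ?nnegrE ?ler01 ?ltW // expr1n -E.
have := e_min t Ut t1; rewrite E expr2 -[leRHS]mul1r ler_pM2r //.
by move=> /(lt_le_trans t1); rewrite ltxx.
Qed.

(** If p1 e3 = t^2 in Q(D), then t / A is a unit negated by [sg]; if 2 p1 e3 = t^2, a further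
    division by 1 + 'i gives one. *)
Lemma minus_one_coboundary :
  ~ (exists n : nat, x + 1 = (n ^ 2)%N%:Z \/ x - 1 = (n ^ 2)%N%:Z) ->
  exists2 u, U u & sg u = - u.
Proof.
move=> Nsq; have S := Qsqrt_subfield (2 * p1 * p2); have KS := K_subfield.
have [Ue e31 _] := fe3; have UKe : U e3.
  by apply: unitO_sub Ue => z Qz; apply/k_sub_K/Qsqrt_sub_k.
have QD : Qsqrt (2 * p1 * p2) D by apply: adj_gen; exact: Qf_subfield.
have p10 : (p1%:R : algC) != 0 by rewrite pnatr_eq0 -lt0n prime_gt0.
have p20 : (p2%:R : algC) != 0 by rewrite pnatr_eq0 -lt0n prime_gt0.
have case_p1 t : Qsqrt (2 * p1 * p2) t -> p1%:R * e3 = t ^+ 2 -> exists2 u, U u & sg u = - u.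
  move=> Qt Dt; have kt := Qsqrt_sub_k Qt; exists (t / A).
    apply: (unitO_sqr KS); first exact: (subfieldM KS (k_sub_K kt) (subfieldV KS K_A)).
    by rewrite expr_div_n -Dt sqrA mulrC mulKf.
  by rewrite fmorph_div sgA (k_fixed kt) invrN mulrN.
have case_2p1 t : Qsqrt (2 * p1 * p2) t -> 2 * p1%:R * e3 = t ^+ 2 -> exists2 u, U u & sg u = - u.
  move=> Qt Dt; have kt := Qsqrt_sub_k Qt; exists (t / A / (1 + 'i)).
    apply: U_half_sqr UKe _; first exact: (subfieldM KS (k_sub_K kt) (subfieldV KS K_A)).
    by rewrite expr_div_n -Dt sqrA -!mulrA [e3 * _]mulrC [p1%:R * _]mulrA divff ?mul1r.
  by rewrite !fmorph_div sgA (k_fixed kt) rmorphD rmorph1 sg_i invrN mulrN mulNr.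
have De3 : e3 = ratr x%:~R + ratr y%:~R * D by rewrite !ratr_int.
have De3' : ss e3 = ratr x%:~R - ratr y%:~R * D by rewrite ss_e3 !ratr_int.
have Z1 : e3 \in Aint by case: Ue => [[]].
have Z2 : ss e3 \in Aint by rewrite Aint_aut.
have pos : 0 < e3 by apply: lt_trans e31; exact: ltr01.
move: pos Z1 Z2 Ne3; rewrite De3' De3 => pos Z1 Z2 N1.
have ev : ~~ odd (2 * p1 * p2) by rewrite -mulnA oddM.
have [x' [d1 [d2 [a [b [/eqP]]]]]] := norm1_class_even squarefree_d pos Z1 Z2 N1 ev.
rewrite eqr_int => /eqP <- D12 Ha Hb; rewrite -De3; set t := _ / _ => Dt.
have Qt : Qsqrt (2 * p1 * p2) t.
  apply: (subfieldM S); first exact: (subfieldD S Qsqrt_e3 (subfield1 S)).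
  apply: (subfieldV S); apply: (subfieldM S); exact: (subfield_nat S).
have QtD q : Qsqrt (2 * p1 * p2) (t * D / q%:R).
  apply: (subfieldM S); first exact: (subfieldM S).
  exact/(subfieldV S)/(subfield_nat S).
have p2_gt0 := prime_gt0 pr2.
(* A factor 1 would make e3 a square, as 2 p1 p2 = D^2, and a factor 2 makes x + 1 or x - 1 a
   square. Multiplication by D turns the classes p2 and 2 p2 into 2 p1 and p1. *)
have [[E|E|E|E]|[E|E|E|E]] := divisors_d D12; move: Dt.
- by rewrite E mul1r => /eqP; rewrite (negPf (e3_not_sqr Qt)).
- by case: Nsq; exists (2 * a)%N; left; rewrite Ha E; rewrite expnMn.
- rewrite E => Dt; apply: (case_2p1 _ (QtD p2)).
  by rewrite expr_div_n exprMn -Dt sqrD !natrM; field.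
- rewrite E natrM => Dt; apply: (case_p1 _ (QtD (2 * p2)%N)).
  by rewrite expr_div_n exprMn -Dt sqrD !natrM; field.
- have D1 : d1 = (2 * p1 * p2)%N by move: D12; rewrite E muln1.
  rewrite D1 => Dt; have /eqP[] := e3_not_sqr (subfieldM S Qt (subfieldV S QD)).
  by rewrite expr_div_n -Dt sqrD [RHS]mulrC mulKf // pnatr_eq0 -lt0n ltnW // gt1_d.
- by case: Nsq; exists (2 * b)%N; right; rewrite Hb E; rewrite expnMn.
- have D1 : d1 = (2 * p1)%N by apply/eqP; rewrite -(eqn_pmul2r p2_gt0) -D12 E.
  by rewrite D1 natrM => Dt; apply: (case_2p1 t).
have D1 : d1 = p1.
  apply/eqP; rewrite -(eqn_pmul2r (_ : 0 < 2 * p2)%N) ?muln_gt0 //.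
  by rewrite -p1_mul_2p2 -E D12.
by rewrite D1 => Dt; apply: (case_p1 t).
Qed.
End SquareClass.
End Automorphisms.
End Multiquadratic.

(* For p1 = p2 the unit 1 + sqrt 2 of Q(sqrt (2 p1 p2)) = Q(sqrt 2) has norm -1. *)
Lemma norm1_distinct_primes (p1 p2 : nat) e : prime p1 -> prime p2 -> odd p1 ->
  fund_unit (2 * p1 * p2) e -> quad_norm (2 * p1 * p2) e 1 -> p1 != p2.
Proof.
move=> pr1 pr2 o1 fe [a [b [De /esym E]]]; apply/eqP => p12; subst p2.
have i2 : ('i : algC) ^+ 2 = ratr (-1) by rewrite sqrCi rmorphN1.
have q2 n : sqrtC (n%:R : algC) ^+ 2 = ratr n%:R by rewrite sqrtCK ratr_nat.
have sp1 := squarefree_prime pr1; have s2 := squarefree_prime (isT : prime 2).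
have s2p1 : squarefree (2 * p1) by apply: squarefree_prime_mul => //; rewrite dvdn2 o1.
have p1_gt1 := prime_gt1 pr1.
have [|nu [_ nuA nu2]] := biquadratic_aut i2 (q2 p1) (q2 2%N).
  apply: sqrt_notin => // q; apply/eqP => E2.
  have lt1 : (1 < 2 * p1)%N by rewrite (leq_trans p1_gt1) // leq_pmull.
  have := squarefree_Nsqr (p1%:R * q) s2p1 lt1.
  by rewrite exprMn expr2 -mulrA -E2 mulrC -natrM eqxx.
set C := sqrtC ((2 * p1 * p1)%:R : algC) in De.
have DC : C = p1%:R * sqrtC 2%:R.
  rewrite /C -mulnA mulnC natrM rootCMl ?ler0n // natrM -expr2 sqrCK ?ler0n //.
have nuC : nu C = - C by rewrite DC rmorphM rmorph_nat nu2 mulrN.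
have C2 : C ^+ 2 = (2 * p1 * p1)%:R by exact: sqrtCK.
have Ne : e * nu e = 1.
  rewrite De aut_lin nuC !fmorph_rat.
  transitivity (ratr a ^+ 2 - ratr b ^+ 2 * C ^+ 2); first by ring.
  transitivity (ratr 1 : algC); last exact: rmorph1.
  by rewrite C2 -E !(rmorphB, rmorphXn, rmorphM) /= ratr_nat; ring.
pose w := 1 + sqrtC (2%:R : algC).
have S := Qsqrt_subfield (2 * p1 * p1).
have p0 : (p1%:R : algC) != 0 by rewrite pnatr_eq0 -lt0n ltnW.
have Qw : Qsqrt (2 * p1 * p1) w.
  apply: (subfieldD S (subfield1 S)).
  have -> : sqrtC (2%:R : algC) = C / p1%:R by rewrite DC mulrC mulKf.
  apply: (subfieldM S); first by apply: adj_gen; exact: Qf_subfield.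
  exact/(subfieldV S)/(subfield_nat S).
have Z2 : sqrtC (2%:R : algC) \in Aint by apply: Aint_sqr; rewrite sqrtCK rpred_nat.
have Nw : w * nu w = -1.
  rewrite /w rmorphD rmorph1 nu2; transitivity (1 - sqrtC (2%:R : algC) ^+ 2); first by ring.
  by rewrite sqrtCK; ring.
have Nw' : w * - nu w = 1 by rewrite mulrN Nw opprK.
have Zw : w \in Aint by rewrite rpredD.
have w_gt0 : 0 < w by rewrite addr_gt0 ?ltr01 // sqrtC_gt0 ltr0n.
have Uw : unitO (Qsqrt (2 * p1 * p1)) w.
  apply: (unitO_inv_Aint S) => //; first exact: lt0r_neq0.
  by rewrite (mulr1_eq Nw') rpredN Aint_aut.
have := fund_unit_norm1 fe Ne Uw w_gt0; rewrite Nw => /eqP.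
by rewrite eq_sym -addr_eq0 -[_ + _]/(2%:R) pnatr_eq0.
Qed.

Theorem theorem29 (p1 p2 : nat) (x y : int) (eps2 : algC) :
  prime p1 -> prime p2 -> (p1 %% 4 = 1)%N -> (p2 %% 4 = 1)%N ->
  fund_unit (2 * p2) eps2 ->
  fund_unit (2 * p1 * p2) (x%:~R + y%:~R * sqrtC (2 * p1 * p2)%:R) ->
  quad_norm (2 * p2) eps2 1 ->
  quad_norm (2 * p1 * p2) (x%:~R + y%:~R * sqrtC (2 * p1 * p2)%:R) 1 ->
  let k := adj (Qsqrt (2 * p1 * p2)) 'i in
  let K1 := adj k (sqrtC p1%:R) in
  ((exists n : nat, x + 1 = (n ^ 2)%:Z \/ x - 1 = (n ^ 2)%:Z) ->
     capitulation_card k K1 4) /\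
  (~ (exists n : nat, x + 1 = (n ^ 2)%:Z \/ x - 1 = (n ^ 2)%:Z) ->
     capitulation_card k K1 2).
Proof.
move=> pr1 pr2 p1_4 p2_4 fe2 fe3 qe2 qe3 k K1.
have p1Np2 : p1 != p2 by apply: norm1_distinct_primes fe3 qe3 => //; clear - p1_4; lia.
have [sg [ss [[sg_i sgD sgA] [ss_i ssA ssD]]]] := galois_exists pr1 pr2 p1_4 p2_4 p1Np2.
have [g [Ug Ng cg]] := @imaginary_unit_exists p1 p2 pr1 p1_4 sg sg_i sgA.
have Ne2 : eps2 * sg eps2 = 1 by apply: (@sg_norm_B p1 p2).
have Ne3 := ss_norm_D ssD qe3.
split=> [[n Hn]|Nsq].
  have [t Qt Dt] := double_e3_sqr ssD fe3 Ne3 Hn.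
  apply: (@capitulation_card4 p1 p2 _ _ _ _ _ sg ss _ _ _ _ _ _ eps2 g) => // u Uu.
  exact: (@minus_one_not_coboundary p1 p2 _ _ _ _ _ sg ss _ _ _ _ _ _ _ t fe3).
have [u Uu su] : exists2 u, unitO K1 u & sg u = - u.
  exact: (@minus_one_coboundary p1 p2 _ _ _ _ _ sg ss _ _ _ _ x y).
exact: (@capitulation_card2 p1 p2 _ _ _ _ _ sg ss _ _ _ _ _ _ eps2 g _ _ _ _ _ u).
Qed.
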